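(* Let $\mathsf{N}_n$ be a uniformly random simplex tree-child network with $n$ taxa. On the event that $\mathsf{N}_n$ has at least one reticulation vertex, let $r_n$ be chosen uniformly at random among the reticulation vertices of $\mathsf{N}_n$ (on the complementary event $r_n$ is an arbitrary vertex). There exists a deterministic infinite rooted network $(\hat{\mathcal{R}},\rho_0)$, namely the one constructed in the context, such that $(\mathsf{N}_n,r_n)\xrightarrow{d}(\hat{\mathcal{R}},\rho_0)$ in the local weak sense as $n\to\infty$.
   Context: A simplex tree-child network on a finite set $X$ is a finite directed acyclic graph $N=(V,E)$ with a root $o$ and with leaves bijectively labelled by $X$, such that: the root has (indegree, outdegree) $=(0,1)$; every vertex is reachable from $o$ by a directed path; every leaf has degree $(1,0)$; every vertex that is neither the root nor a leaf is either a tree vertex, of degree $(1,2)$, or a reticulation vertex, of degree $(2,1)$; (tree-child) every non-leaf vertex has at least one child that is a tree vertex or a leaf; (one-component) the unique child of every reticulation vertex is a leaf. Networks are considered up to isomorphism preserving leaf labels. $\mathsf{N}_n$ is uniform on the finite set of simplex tree-child networks with leaf label set $[n]$. Local neighbourhoods: for a directed graph $N$ and $v\in V(N)$, $U_R(N,v)$ is the subgraph induced by the vertices at undirected graph distance at most $R$ from $v$, rooted at $v$. Each vertex carries a mark giving its type in $N$ (root, tree vertex, reticulation, or leaf); leaf labels are ignored. $\cong$ denotes isomorphism of rooted directed marked graphs, i.e. a bijection of vertex sets preserving root, marks, edges and edge orientations. Local weak convergence $(N_n,v_n)\xrightarrow{d}(N,v)$ means $\mathbb{P}(U_R(N_n,v_n)\cong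 G)\to\mathbb{P}(U_R(N,v)\cong G)$ for every fixed $R\ge0$ and every finite rooted directed marked graph $G$; for deterministic $(N,v)$ this is $\mathbb{P}(U_R(N_n,v_n)\cong U_R(N,v))\to1$ for every $R\ge0$. Construction. A bi-infinite spine is a bi-infinite directed path $\cdots\to x_{-1}\to x_0\to x_1\to\cdots$ of tree vertices. To decorate a tree vertex $x$ means: give $x$ a new reticulation child $\rho(x)$; give $\rho(x)$ a new leaf child $\ell(x)$; and give $\rho(x)$ a second parent $w(x)$, which is a tree vertex on a new bi-infinite spine, all of whose vertices other than $w(x)$ are in turn decorated, recursively (the reticulation child of $w(x)$ is $\rho(x)$). All spines and vertices introduced at every level are pairwise distinct. The reticulation limit $\hat{\mathcal{R}}$ has two disjoint bi-infinite spines $\cdots\to p_{-1}\to p_0\to p_1\to\cdots$ and $\cdots\to q_{-1}\to q_0\to q_1\to\cdots$, and a reticulation $\rho_0$ whose two parents are $p_0$ and $q_0$ and whose only child is a leaf $\ell_0$; every spine vertex $p_i,q_i$ with $i\ne0$ is decorated, while $p_0,q_0$ have $\rho_0$ as their only reticulation child. It is rooted at $\rho_0$. *)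

(* Defs.v *)
From HB Require Import structures.
From mathcomp Require Import all_boot all_order all_algebra finmap.
From mathcomp Require Import all_classical all_reals all_analysis.
From mathcomp Require Import zify.

Set Implicit Arguments.
Unset Strict Implicit.
Unset Printing Implicit Defensive.

Import Order.TTheory GRing.Theory Num.Theory.
Local Open Scope ring_scope.
Local Open Scope classical_set_scope.

(** * Rooted directed marked graphs and their local neighbourhoods *)

Variant vkind := Root | TreeVertex | Reticulation | Leaf.

(* The vertex type is arbitrary, so that both finite networks and the infinite
   limit are instances. [rm_base] is the distinguished vertex of the rooted
   graph; it is unrelated to the root of a network (the vertex marked [Root]). *)
Record rmgraph := RMGraph {
  vtx :> Type;
  rm_arc : vtx -> vtx -> Prop;
  rm_mark : vtx -> vkind;
  rm_base : vtx }.

Arguments rm_arc : clear implicits.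
Arguments rm_mark : clear implicits.
Arguments rm_base : clear implicits.

(* [within G R u v]: the undirected graph distance of u and v is at most R. *)
Fixpoint within (G : rmgraph) (R : nat) (u v : G) : Prop :=
  match R with
  | 0%N => u = v
  | R'.+1 => within R' u v \/
      exists w : G, within R' u w /\ (rm_arc G w v \/ rm_arc G v w)
  end.

Lemma within_refl (G : rmgraph) (R : nat) (u : G) : within R u u.
Proof. by elim: R => [|R IH] //=; left. Qed.

(* U_R(G, rm_base): the induced subgraph, with the marks inherited from G. *)
Definition local_ball (R : nat) (G : rmgraph) : rmgraph := {|
  vtx := {v : G | within R (rm_base G) v};
  rm_arc := fun u v => rm_arc G (sval u) (sval v);
  rm_mark := fun v => rm_mark G (sval v);
  rm_base := exist _ (rm_base G) (within_refl R (rm_base G)) |}.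

Definition rm_iso (G H : rmgraph) : Prop :=
  exists f : G -> H,
    [/\ bijective f,
        f (rm_base G) = rm_base H,
        forall v, rm_mark H (f v) = rm_mark G v
      & forall u v, rm_arc H (f u) (f v) <-> rm_arc G u v].

(** * Simplex tree-child networks *)

Section Degrees.
Variables (V : finType) (E : {set V * V}).

Definition arcrel : rel V := fun u v => (u, v) \in E.
Definition indeg (v : V) : nat := #|[pred u | arcrel u v]|.
Definition outdeg (v : V) : nat := #|[pred u | arcrel v u]|.
Definition has_degree (v : V) (d : nat * nat) : bool := (indeg v, outdeg v) == d.
Definition is_tree (v : V) : bool := has_degree v (1, 2)%N.
Definition is_ret (v : V) : bool := has_degree v (2, 1)%N.

End Degrees.

Section SimplexTreeChild.
Variables (n : nat) (V : finType) (E : {set V * V}) (o : V).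
Variable lab : {ffun 'I_n -> V}.

Definition is_leaf (v : V) : bool := v \in codom lab.

Record simplex_tree_child : Prop := {
  stc_acyclic : forall u v, arcrel E u v -> ~~ connect (arcrel E) v u;
  stc_root : has_degree E o (0, 1)%N;
  stc_reachable : forall v, connect (arcrel E) o v;
  stc_label_inj : injective lab;
  stc_leaf : forall v, is_leaf v -> has_degree E v (1, 0)%N;
  stc_inner : forall v, v != o -> ~~ is_leaf v -> is_tree E v || is_ret E v;
  stc_tree_child : forall v, ~~ is_leaf v ->
    exists2 w, arcrel E v w & is_tree E w || is_leaf w;
  stc_one_component : forall v w, is_ret E v -> arcrel E v w -> is_leaf w }.

End SimplexTreeChild.

(* Every finite network is isomorphic to one on an initial segment of nat. *)
Record network (n : nat) := Network {
  net_order : nat;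
  net_arcs : {set 'I_net_order * 'I_net_order};
  net_root : 'I_net_order;
  net_label : {ffun 'I_n -> 'I_net_order};
  network_axiom : simplex_tree_child net_arcs net_root net_label }.

Definition reticulations (n : nat) (N : network n) : {set 'I_(net_order N)} :=
  [set v | is_ret (net_arcs N) v].

(* Isomorphism preserving leaf labels; it automatically preserves the root, the
   only vertex of indegree 0. *)
Definition net_iso (n : nat) (N M : network n) : Prop :=
  exists f : 'I_(net_order N) -> 'I_(net_order M),
    [/\ bijective f,
        forall u v, arcrel (net_arcs M) (f u) (f v) = arcrel (net_arcs N) u v
      & forall i, f (net_label N i) = net_label M i].

Definition iso_classes (n : nat) : set (set (network n)) :=
  [set [set M | net_iso N M] | N in [set: network n]].

Definition net_mark (n : nat) (N : network n) (v : 'I_(net_order N)) : vkind :=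
  if v == net_root N then Root
  else if is_leaf (net_label N) v then Leaf
  else if v \in reticulations N then Reticulation
  else TreeVertex.

(* A network with a distinguished vertex. *)
Definition pointed_network (n : nat) := {N : network n & 'I_(net_order N)}.

Definition pointed_graph (n : nat) (x : pointed_network n) : rmgraph := {|
  vtx := 'I_(net_order (projT1 x));
  rm_arc := fun u v => arcrel (net_arcs (projT1 x)) u v;
  rm_mark := @net_mark n (projT1 x);
  rm_base := projT2 x |}.

(** ** There are finitely many isomorphism classes *)

Lemma card_pred_sum (T : finType) (P : pred T) :
  #|[pred x | P x]| = (\sum_x P x)%N.
Proof.
rewrite -sum1_card big_mkcond; apply: eq_bigr => x _.
by rewrite inE; case: (P x).
Qed.

Lemma net_order_bound n (N : network n) : (net_order N <= 4 * n)%N.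
Proof.
case: N => m E o lab [_ Hr _ Hinj Hleaf Hin _ Hone] /=.
set L := is_leaf lab in Hleaf Hin Hone *.
have EL : (\sum_x L x = n)%N.
  rewrite -card_pred_sum.
  transitivity #|codom lab|; first by apply: eq_card => x; rewrite inE.
  by rewrite card_codom // card_ord.
have S : (\sum_v outdeg E v = \sum_v indeg E v)%N.
  under eq_bigr => v _ do rewrite /outdeg card_pred_sum.
  under [RHS]eq_bigr => v _ do rewrite /indeg card_pred_sum.
  by rewrite exchange_big.
have P v : (outdeg E v + (2 * L v + 2 * is_ret E v) = indeg E v + 1)%N.
  case Lv: (L v).
    move: (Hleaf v Lv); rewrite /is_ret /has_degree => /eqP e; rewrite e.
    by case: e => -> ->.
  have [->|no] := eqVneq v o.
    move: Hr; rewrite /is_ret /has_degree => /eqP e; rewrite e.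
    by case: e => -> ->.
  move: (Hin v no (negbT Lv)) => /orP[];
    rewrite /is_tree /is_ret /has_degree => /eqP e; rewrite e;
    by case: e => -> ->.
have Q : (\sum_v is_ret E v <= n)%N.
  have : (\sum_v is_ret E v <= \sum_v \sum_(w | L w) arcrel E v w)%N.
    apply: leq_sum => v _; case rv: (is_ret E v) => //.
    move: (rv); rewrite /is_ret /has_degree => /eqP[_ o1].
    have /card_gt0P[w] : (0 < #|[pred u | arcrel E v u]|)%N.
      by rewrite -/(outdeg E v) o1.
    rewrite inE => vw; rewrite (bigD1 w) /=; last exact: Hone vw.
    by rewrite vw.
  rewrite exchange_big /= => /leq_trans; apply.
  rewrite -[X in (_ <= X)%N]EL [X in (_ <= X)%N](bigID L) /=.
  rewrite -[leqLHS]addn0 leq_add //.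
  apply: leq_sum => w Lw; rewrite -card_pred_sum -/(indeg E w).
  by move: (Hleaf w Lw) => /eqP[-> _]; rewrite Lw.
have fin : (\sum_v (outdeg E v + (2 * L v + 2 * is_ret E v)) =
            \sum_(v : 'I_m) (indeg E v + 1))%N.
  by apply: eq_bigr => v _; exact: P.
move: fin Q; rewrite !big_split /= S sum1_card card_ord !big1_eq EL.
set q := (\sum_v nat_of_bool _)%N; set z := (\sum_v indeg _ _)%N.
by move: z q => z q; lia.
Qed.

Definition net_data (n m : nat) : finType :=
  ({set 'I_m * 'I_m} * 'I_m * {ffun 'I_n -> 'I_m})%type.

Definition net_code (n : nat) : finType :=
  {m : 'I_(4 * n)%N.+1 & net_data n m}.

Definition net_enc n (N : network n) : net_code n :=
  existT (fun m : 'I_(4 * n)%N.+1 => net_data n m)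
    (Ordinal (net_order_bound N : (net_order N < (4 * n).+1)%N))
    (net_arcs N, net_root N, net_label N).

Lemma net_enc_inj n : injective (@net_enc n).
Proof.
move=> [m E o l a] [m' E' o' l' a'] e.
pose g (c : net_code n) : {m : nat & net_data n m} :=
  existT (net_data n) (val (tag c)) (tagged c).
have {e} := congr1 (@g) e.
rewrite /g /net_enc /= => e.
have em := congr1 (@projT1 _ _) e; simpl in em; subst m'.
move/eqP: e; rewrite eq_Tagged /= => /eqP[eE eo el]; subst.
by rewrite (Prop_irrelevance a a').
Qed.

Lemma finite_iso_classes n : finite_set (@iso_classes n).
Proof.
apply: finite_image.
have -> : [set: network n] = @net_enc n @^-1` [set: net_code n] by [].
apply: finite_preimage; last exact: finite_finset.
by move=> x y _ _; exact: net_enc_inj.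
Qed.

(** * Random networks *)

(* X = (N, r) with N uniform over the isomorphism classes and, given N with at
   least one reticulation, r uniform over the reticulations of N; nothing is
   required of r when N has none. The values of X form a countable set, which
   carries the discrete sigma-algebra. *)
Record uniform_network_reticulation (R : realType) (d : measure_display)
    (T : measurableType d) (P : probability T R) (n : nat)
    (X : T -> pointed_network n) : Prop := {
  unr_measurable : forall x, measurable (X @^-1` [set x]);
  unr_network : forall N : network n,
    P [set t | net_iso N (projT1 (X t))] =
      ((#|` fset_set (@iso_classes n)|%:R : R)^-1)%:E;
  unr_reticulation : forall (N : network n) (v : 'I_(net_order N)),
    v \in reticulations N ->
    P [set t | X t = existT _ N v] =
      (P [set t | projT1 (X t) = N] * ((#|reticulations N|%:R : R)^-1)%:E)%E }.

(* Local weak convergence of random pointed networks, each on its own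
   probability space, to a deterministic rooted marked graph. *)
Definition local_weak_cvg (R : realType) (d : nat -> measure_display)
    (T : forall n, measurableType (d n)) (P : forall n, probability (T n) R)
    (s : nat -> nat) (X : forall n, T n -> pointed_network (s n))
    (L : rmgraph) : Prop :=
  forall k : nat,
    (fun n => P n [set t | rm_iso (local_ball k (pointed_graph (X n t)))
                                  (local_ball k L)])
      @ \oo --> (1%E : \bar R).

(** * The reticulation limit *)

(* On every spine the vertices are indexed by int, and the vertex of index 0 is
   the one which is not decorated: p_0 and q_0 on the two initial spines, and
   w(x) on the spine introduced when decorating x. The decorated vertices are
   thus the pairs of a spine and a nonzero index, and each gives one spine. *)
Definition nzint := {i : int | i != 0}.

Inductive spine :=
  | SpineP
  | SpineQ
  | SpineW of spine & nzint.

Inductive limit_vertex :=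
  | SpineVertex of spine & int
  | Ret0
  | Leaf0
  | Ret of spine & nzint
  | RetLeaf of spine & nzint.

Inductive limit_arc : limit_vertex -> limit_vertex -> Prop :=
  | arc_spine s i : limit_arc (SpineVertex s i) (SpineVertex s (i + 1))
  | arc_p0 : limit_arc (SpineVertex SpineP 0) Ret0
  | arc_q0 : limit_arc (SpineVertex SpineQ 0) Ret0
  | arc_leaf0 : limit_arc Ret0 Leaf0
  | arc_decorated s (i : nzint) : limit_arc (SpineVertex s (sval i)) (Ret s i)
  | arc_w s (i : nzint) : limit_arc (SpineVertex (SpineW s i) 0) (Ret s i)
  | arc_leaf s (i : nzint) : limit_arc (Ret s i) (RetLeaf s i).

Definition limit_mark (v : limit_vertex) : vkind :=
  match v with
  | SpineVertex _ _ => TreeVertex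
  | Ret0 | Ret _ _ => Reticulation
  | Leaf0 | RetLeaf _ _ => Leaf
  end.

Definition reticulation_limit : rmgraph := {|
  vtx := limit_vertex;
  rm_arc := limit_arc;
  rm_mark := limit_mark;
  rm_base := Ret0 |}.

(* Main.v *)
Require Import Defs.
From HB Require Import structures.
From mathcomp Require Import all_boot all_order all_algebra.
From mathcomp Require Import all_classical all_reals all_analysis.
From mathcomp Require Import perm zify ring lra.

(* A neighbourhood of a reticulation is covered by the limit, by following
   spines, as long as it contains no special vertex, that is, no root, no
   branch vertex (a tree vertex without reticulation child) and no leaf whose
   parent is not a reticulation. The covering is an isomorphism onto the
   neighbourhood if moreover there is no short cycle. A network with n taxa
   and r reticulations has at most 2 (n - r) special vertices, and degrees are
   at most 3, so it is enough to show that n - r = o(n) with high probability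
   and that the expected number of reticulations on short cycles is bounded.
   Both follow from double counting, which is valid for isomorphism classes
   because networks have no automorphisms. For the first claim, take a branch
   vertex b with a child v and a leaf a whose parent is not a reticulation and
   which is not below v; exchange v and a, then insert a reticulation between b
   and a, with a second parent anywhere: there are of order (n - r)^2 n choices
   and each result arises in O(n^2) ways. For the second, exchange a
   reticulation on a short cycle with another one: there are r - O(1) choices,
   and the results are pairs of parents at bounded distance from a prescribed
   vertex, of which there are O(n). *)

Set Implicit Arguments.
Unset Strict Implicit.
Unset Printing Implicit Defensive.

(** * Degrees and kinds of vertices *)

(** Degree counting gives exactly [n - r - 1] branch vertices and [n - r] leaves with a
    non-reticulation parent, so the single number [n - r] controls every kind of special vertex. A
    reticulation can be inserted above a leaf only if the parent of the leaf is a branch vertex, and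
    a network may have no such leaf. The exchange of [v] and [a] removes this obstacle, at the price
    of a factor of order [n] for remembering [v]. The insertion in turn bounds the mean number of
    such leaves by about 2: there are at least [n - 1] places for the second parent, while the
    inserted reticulation is found again from one of the [2 r < 2 n] arcs into reticulations. Hence
    [n - r >= n / M] has probability O(M^2 / n), which also covers the networks without
    reticulations. For cycles the orientation helps: the vertex of highest rank on an undirected
    cycle has both its cycle neighbours as parents, hence is a reticulation, and exchanging an arc
    into it with an arc into another reticulation creates no directed cycle, because only a leaf
    lies below a reticulation. *)

Section Degrees.
Variables (V : finType) (E : {set V * V}).

Lemma indeg_sum v : indeg E v = \sum_u arcrel E u v.
Proof. exact: card_pred_sum. Qed.

Lemma outdeg_sum v : outdeg E v = \sum_u arcrel E v u.
Proof. exact: card_pred_sum. Qed.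

Lemma has_degreeP v i j :
  reflect (indeg E v = i /\ outdeg E v = j) (has_degree E v (i, j)).
Proof. by apply: (iffP eqP) => [[-> ->]|[-> ->]]. Qed.

Lemma indeg_gt0 u v : arcrel E u v -> 0 < indeg E v.
Proof. by move=> uv; apply/card_gt0P; exists u. Qed.

Lemma outdeg_gt0 u v : arcrel E u v -> 0 < outdeg E u.
Proof. by move=> uv; apply/card_gt0P; exists v. Qed.

Lemma indeg0 u v : indeg E v = 0 -> arcrel E u v = false.
Proof. by move=> d; apply/negP => /indeg_gt0; rewrite d. Qed.

Lemma outdeg0 u v : outdeg E u = 0 -> arcrel E u v = false.
Proof. by move=> d; apply/negP => /outdeg_gt0; rewrite d. Qed.

Lemma indeg1 v u u' : indeg E v <= 1 -> arcrel E u v -> arcrel E u' v -> u = u'.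
Proof. by move=> /card_le1_eqP h uv u'v; apply: h. Qed.

Lemma outdeg1 v u u' : outdeg E v <= 1 -> arcrel E v u -> arcrel E v u' -> u = u'.
Proof. by move=> /card_le1_eqP h uv u'v; apply: h. Qed.

Definition pa (v : V) : V := odflt v [pick u | arcrel E u v].

Lemma pa_arc v : 0 < indeg E v -> arcrel E (pa v) v.
Proof.
rewrite /pa; case: pickP => //= h /card_gt0P[u].
by rewrite inE h.
Qed.

Lemma pa_uniq u v : indeg E v <= 1 -> arcrel E u v -> u = pa v.
Proof.
by move=> h uv; apply: (indeg1 h uv); apply: pa_arc; apply: indeg_gt0 uv.
Qed.

Lemma outdeg2 v (a b c : V) : outdeg E v <= 2 -> arcrel E v a -> arcrel E v b ->
  arcrel E v c -> a != b -> c = a \/ c = b.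
Proof.
move=> h va vb vc ab; have [->|ca] := eqVneq c a; first by left.
have [->|cb] := eqVneq c b; first by right.
suff : 2 < outdeg E v by rewrite ltnNge h.
have <- : #|[set a; b; c]| = 3.
  by rewrite finset.setUC cardsU1 cards2 !inE (negbTE ca) (negbTE cb) ab.
by apply/subset_leq_card/fintype.subsetP => x; rewrite !inE => /orP[/orP[]|] /eqP->.
Qed.

Lemma indeg2 v (a b c : V) : indeg E v <= 2 -> arcrel E a v -> arcrel E b v ->
  arcrel E c v -> a != b -> c = a \/ c = b.
Proof.
move=> h va vb vc ab; have [->|ca] := eqVneq c a; first by left.
have [->|cb] := eqVneq c b; first by right.
suff : 2 < indeg E v by rewrite ltnNge h.
have <- : #|[set a; b; c]| = 3.
  by rewrite finset.setUC cardsU1 cards2 !inE (negbTE ca) (negbTE cb) ab.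
by apply/subset_leq_card/fintype.subsetP => x; rewrite !inE => /orP[/orP[]|] /eqP->.
Qed.

Lemma indeg2_other v : indeg E v = 2 -> forall a, arcrel E a v ->
  exists2 b, arcrel E b v & b != a.
Proof.
move=> d a av; move: d; rewrite /indeg (cardD1 a) inE av add1n => -[d].
have /card_gt0P[b] : 0 < #|[predD1 [pred u | arcrel E u v] & a]| by rewrite d.
by rewrite !inE => /andP[ba bv]; exists b.
Qed.

Lemma outdeg2_other v : outdeg E v = 2 -> forall a, arcrel E v a ->
  exists2 b, arcrel E v b & b != a.
Proof.
move=> d a av; move: d; rewrite /outdeg (cardD1 a) inE av add1n => -[d].
have /card_gt0P[b] : 0 < #|[predD1 [pred u | arcrel E v u] & a]| by rewrite d.
by rewrite !inE => /andP[ba bv]; exists b.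
Qed.

End Degrees.

Definition is_branch (V : finType) (E : {set V * V}) (b : V) : bool :=
  is_tree E b && [forall c, arcrel E b c ==> ~~ is_ret E c].

Section Construction.
Variables (n : nat) (V : finType) (E : {set V * V}) (o : V).
Variable lab : {ffun 'I_n -> V}.

(* Acyclicity is certified by a rank increasing along the arcs; reachability
   from the root is then automatic since only the root has indegree 0. *)
Lemma simplex_tree_child_of_rank (h : V -> nat) :
  (forall u v, arcrel E u v -> h u < h v) ->
  has_degree E o (0, 1) -> injective lab ->
  (forall v, is_leaf lab v -> has_degree E v (1, 0)) ->
  (forall v, v != o -> ~~ is_leaf lab v -> is_tree E v || is_ret E v) ->
  (forall v, ~~ is_leaf lab v ->
     exists2 w, arcrel E v w & is_tree E w || is_leaf lab w) ->
  (forall v w, is_ret E v -> arcrel E v w -> is_leaf lab w) ->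
  simplex_tree_child E o lab.
Proof.
move=> hh ro li le inn tc oc; split=> //.
- move=> u v uv; apply/negP => /connectP[p pp ep].
  have : h v <= h u.
    rewrite ep; elim: p v pp {ep uv} => //= w p IH v /andP[vw pp].
    by apply: leq_trans (ltnW (hh _ _ vw)) (IH _ pp).
  by rewrite leqNgt hh.
- move=> v; have [k] := ubnP (h v); elim: k v => // k IH v.
  rewrite ltnS => hk; have [->|vo] := eqVneq v o; first exact: connect0.
  have dv : 0 < indeg E v.
    have [lv|lv] := boolP (is_leaf lab v); first by case/has_degreeP: (le _ lv) => ->.
    by case/orP: (inn _ vo lv) => /has_degreeP[->].
  have pv := pa_arc dv; apply: connect_trans (connect1 pv).
  by apply: IH; apply: leq_trans (hh _ _ pv) hk.
Qed.

End Construction.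

(** * Local structure of a simplex tree-child network *)

Section Network.
Variables (n : nat) (V : finType) (E : {set V * V}) (o : V).
Variable lab : {ffun 'I_n -> V}.
Hypothesis H : simplex_tree_child E o lab.

Notation arc := (arcrel E).
Notation ret := (is_ret E).
Notation tree := (is_tree E).
Notation leaf := (is_leaf lab).

Lemma kindP v : [\/ v = o, leaf v, tree v | ret v].
Proof.
have [->|vo] := eqVneq v o; first by constructor 1.
have [lv|lv] := boolP (leaf v); first by constructor 2.
by case/orP: (stc_inner H vo lv) => h; [constructor 3|constructor 4].
Qed.

Lemma root_deg : indeg E o = 0 /\ outdeg E o = 1.
Proof. exact/has_degreeP/(stc_root H). Qed.
Lemma leaf_deg v : leaf v -> indeg E v = 1 /\ outdeg E v = 0.
Proof. by move=> lv; apply/has_degreeP/(stc_leaf H). Qed.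
Lemma tree_deg v : tree v -> indeg E v = 1 /\ outdeg E v = 2.
Proof. by move=> lv; apply/has_degreeP. Qed.
Lemma ret_deg v : ret v -> indeg E v = 2 /\ outdeg E v = 1.
Proof. by move=> lv; apply/has_degreeP. Qed.

Lemma treeE v : tree v = ((indeg E v == 1) && (outdeg E v == 2)). Proof. by []. Qed.
Lemma retE v : ret v = ((indeg E v == 2) && (outdeg E v == 1)). Proof. by []. Qed.
Lemma leafE v : leaf v = (outdeg E v == 0).
Proof.
case: (kindP v) => [->|lv|tv|rv].
- have [r1 r2] := root_deg; rewrite r2; apply/negP => /leaf_deg[].
  by rewrite r1.
- by rewrite lv; case: (leaf_deg lv) => _ ->.
- case: (tree_deg tv) => i1 i2; rewrite i2; apply/negP => /leaf_deg[].
  by rewrite i1 i2.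
- case: (ret_deg rv) => i1 i2; rewrite i2; apply/negP => /leaf_deg[].
  by rewrite i1 i2.
Qed.
Lemma root_indeg0 v : (v == o) = (indeg E v == 0).
Proof.
apply/eqP/eqP => [->|d]; first by case: root_deg.
case: (kindP v) => [//|/leaf_deg[]|/tree_deg[]|/ret_deg[]]; by rewrite d.
Qed.

Lemma ret_tree v : ret v -> tree v = false.
Proof. by move=> /ret_deg[i1 i2]; rewrite treeE i1 i2. Qed.
Lemma ret_leaf v : ret v -> leaf v = false.
Proof. by move=> /ret_deg[i1 i2]; rewrite leafE i2. Qed.
Lemma tree_ret v : tree v -> ret v = false.
Proof. by move=> /tree_deg[i1 i2]; rewrite retE i1 i2. Qed.
Lemma tree_leaf v : tree v -> leaf v = false.
Proof. by move=> /tree_deg[i1 i2]; rewrite leafE i2. Qed.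
Lemma leaf_ret v : leaf v -> ret v = false.
Proof. by move=> /leaf_deg[i1 i2]; rewrite retE i1 i2. Qed.
Lemma leaf_tree v : leaf v -> tree v = false.
Proof. by move=> /leaf_deg[i1 i2]; rewrite treeE i1 i2. Qed.
Lemma root_ret : ret o = false.
Proof. by case: root_deg => i1 i2; rewrite retE i1 i2. Qed.
Lemma root_tree : tree o = false.
Proof. by case: root_deg => i1 i2; rewrite treeE i1 i2. Qed.
Lemma root_leaf : leaf o = false.
Proof. by case: root_deg => i1 i2; rewrite leafE i2. Qed.

Lemma arc_root u : arc u o = false.
Proof. by apply: indeg0; case: root_deg. Qed.
Lemma leaf_arc u v : leaf u -> arc u v = false.
Proof. by case/leaf_deg => _ d; apply: outdeg0. Qed.

Lemma arc_connectN u v : arc u v -> connect arc v u = false.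
Proof. by move=> uv; apply/negbTE/(stc_acyclic H). Qed.

Lemma arc_irr u : arc u u = false.
Proof. by apply/negP => h; have := arc_connectN h; rewrite connect0. Qed.

(** The number of ancestors is a topological order: along an arc the set of ancestors grows
    strictly. *)
Definition rank v := #|[pred u | connect arc u v]|.

Lemma rank_arc u v : arc u v -> rank u < rank v.
Proof.
move=> uv; apply: proper_card; apply/properP; split.
  by apply/fintype.subsetP => w; rewrite !inE => /connect_trans; apply; apply: connect1.
by exists v; rewrite !inE ?connect0 // arc_connectN.
Qed.

Lemma rank_lt v : rank v < #|V|.+1.
Proof. by rewrite ltnS max_card. Qed.

Lemma nret_indeg v : ~~ ret v -> indeg E v <= 1.
Proof.
case: (kindP v) => [->|/leaf_deg[->]|/tree_deg[->]|->] //.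
by case: root_deg => ->.
Qed.

Lemma nret_pa u v : ~~ ret v -> arc u v -> u = pa E v.
Proof. by move=> h; apply: pa_uniq; apply: nret_indeg. Qed.

Lemma nret_uniq u u' v : ~~ ret v -> arc u v -> arc u' v -> u = u'.
Proof. by move=> h; apply: indeg1; apply: nret_indeg. Qed.

(** A root above a reticulation would have no other child, against tree-child; a reticulation above
    one would violate one-component. *)
Lemma par_ret u v : arc u v -> ret v -> tree u.
Proof.
move=> uv rv; case: (kindP u) => // [uo|lu|ru].
- have := root_leaf; rewrite -uo => /negbT nlo.
  case: (stc_tree_child H nlo) => w ow; rewrite (outdeg1 _ ow uv).
    by rewrite ret_tree // ret_leaf.
  by rewrite uo; case: root_deg => _ ->.
- by rewrite leaf_arc in uv.
- by have := stc_one_component H ru uv; rewrite ret_leaf.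
Qed.

Lemma par_tree u v : arc u v -> tree v -> ~~ ret u.
Proof.
move=> uv tv; apply/negP => ru.
by have := stc_one_component H ru uv; rewrite tree_leaf.
Qed.

(** Two reticulations would exhaust the children of a tree vertex, against tree-child. A
    reticulation can therefore be recorded by any one of its parents. *)
Lemma ret_child_uniq u v v' : arc u v -> arc u v' -> ret v -> ret v' -> v = v'.
Proof.
move=> uv uv' rv rv'; apply/eqP/negPn/negP => ne.
have tu := par_ret uv rv; case: (stc_tree_child H (negbT (tree_leaf tu))) => w uw.
have [|->|->] := outdeg2 _ uv uv' uw ne; first by case: (tree_deg tu) => _ ->.
  by rewrite ret_tree // ret_leaf.
by rewrite ret_tree // ret_leaf.
Qed.

Lemma nret_child_uniq u r v v' : arc u r -> ret r -> arc u v -> arc u v' ->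
  ~~ ret v -> ~~ ret v' -> v = v'.
Proof.
move=> ur rr uv uv' rv rv'; apply/eqP/negPn/negP => ne.
have tu := par_ret ur rr.
have [|e|e] := outdeg2 _ uv uv' ur ne; first by case: (tree_deg tu) => _ ->.
  by move: rv; rewrite -e rr.
by move: rv'; rewrite -e rr.
Qed.

Lemma ret_connect r v : ret r -> connect arc r v -> v = r \/ leaf v.
Proof.
move=> rr /connectP[[|w p] /=]; first by move=> _ ->; left.
case/andP=> rw; have lw := stc_one_component H rr rw.
case: p => [|x p] /=; first by move=> _ ->; right.
by rewrite leaf_arc.
Qed.

Lemma leaf_connect l v : leaf l -> connect arc l v -> v = l.
Proof.
by move=> ll /connectP[[|w p] /=]; [move=> _ ->|rewrite leaf_arc].
Qed.

End Network.

(** * Counting vertices by kind *)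

Lemma card_set_sum (T : finType) (P : pred T) : #|[set x | P x]| = \sum_x P x.
Proof. by rewrite cardsE -card_pred_sum; apply: eq_card => x; rewrite inE. Qed.

Section Counting.
Variables (n : nat) (V : finType) (E : {set V * V}) (o : V).
Variable lab : {ffun 'I_n -> V}.
Hypothesis H : simplex_tree_child E o lab.

Notation arc := (arcrel E).
Notation ret := (is_ret E).
Notation tree := (is_tree E).
Notation leaf := (is_leaf lab).

Definition base_leaf v := leaf v && ~~ ret (pa E v).

Lemma sum_leaf : \sum_v leaf v = n.
Proof.
rewrite -card_pred_sum; transitivity #|codom lab|.
  by apply: eq_card => x; rewrite inE.
by rewrite card_codom ?card_ord //; apply: stc_label_inj H.
Qed.

(** Outdegree minus indegree is 1 at the root and at tree vertices, -1 at leaves and reticulations,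
    and sums to 0. *)
Lemma sum_tree : (\sum_v tree v).+1 = n + \sum_v ret v.
Proof.
have S : \sum_v outdeg E v = \sum_v indeg E v.
  under eq_bigr => v _ do rewrite outdeg_sum.
  by rewrite exchange_big; apply: eq_bigr => v _; rewrite indeg_sum.
have : \sum_v (outdeg E v + (leaf v + ret v)) = \sum_v (indeg E v + (tree v + (v == o))).
  apply: eq_bigr => v _; case: (kindP H v) => [->|h|h|h].
  - rewrite eqxx (root_leaf H) (root_ret H) (root_tree H).
    by case: (root_deg H) => -> ->.
  - rewrite h (leaf_ret H h) (leaf_tree H h) (root_indeg0 H).
    by case: (leaf_deg H h) => -> ->.
  - rewrite h (tree_ret h) (tree_leaf H h) (root_indeg0 H).
    by case: (tree_deg h) => -> ->.
  - rewrite h (ret_tree h) (ret_leaf H h) (root_indeg0 H).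
    by case: (ret_deg h) => -> ->.
rewrite !big_split /= S => /eqP; rewrite eqn_add2l sum_leaf => /eqP ->.
rewrite [X in _ = _ + X](_ : _ = 1) ?addn1 //.
by rewrite (bigD1 o) //= eqxx big1 // => v /negbTE ->.
Qed.

Lemma sum_ret_arc : \sum_u \sum_v (arc u v && ret v : nat) = 2 * \sum_v ret v.
Proof.
rewrite exchange_big big_distrr /=; apply: eq_bigr => v _.
case rv: (ret v); last by rewrite big1 // => u _; rewrite andbF.
under eq_bigr => u _ do rewrite andbT.
by rewrite -indeg_sum; case: (ret_deg rv).
Qed.

Lemma branchPn u : tree u -> ~~ is_branch E u -> exists2 v, arc u v & ret v.
Proof.
move=> tu; rewrite /is_branch tu /= => /forallPn[v].
by rewrite negb_imply negbK => /andP[]; exists v.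
Qed.

(** A tree vertex is either a branch vertex or the parent of exactly one reticulation, and each
    reticulation has two parents, all tree vertices; hence there are [2 r] tree vertices besides the
    branch vertices. *)
Lemma sum_branch : (\sum_v is_branch E v + \sum_v ret v).+1 = n.
Proof.
have e : \sum_u (tree u) = \sum_u (is_branch E u + \sum_v (arc u v && ret v)).
  apply: eq_bigr => u _; have [tu|tu] := boolP (tree u); last first.
    rewrite /is_branch (negbTE tu) big1 // => v _.
    by case uv: (arc u v) => //; case rv: (ret v) => //; rewrite (par_ret H uv rv) in tu.
  have [/andP[_ /forallP b]|b] := boolP (is_branch E u).
    rewrite big1 // => v _; have := b v.
    by case: (arc u v) => //= /negbTE ->.
  have [v uv rv] := branchPn tu b.
  rewrite (bigD1 v) //= uv rv big1 // => w wv.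
  case uw: (arc u w) => //; case rw: (ret w) => //.
  by rewrite (ret_child_uniq H uw uv rw rv) eqxx in wv.
have := sum_tree; rewrite e big_split /= sum_ret_arc mul2n -addnn.
by move: (\sum_v is_branch E v) (\sum_v ret v) => a b; lia.
Qed.

(** Reticulations are in bijection with the leaves below them. *)
Lemma sum_base_leaf : \sum_v base_leaf v + \sum_v ret v = n.
Proof.
rewrite -sum_leaf.
have -> : \sum_v ret v = \sum_v \sum_u (arc u v && ret u).
  rewrite exchange_big /=; apply: eq_bigr => u _.
  case ru: (ret u); last by rewrite big1 // => v _; rewrite andbF.
  under eq_bigr => v _ do rewrite andbT.
  by rewrite -outdeg_sum; case: (ret_deg ru).
rewrite -big_split /=; apply: eq_bigr => v _; rewrite /base_leaf.
have [lv|lv] /= := boolP (leaf v); last first.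
  rewrite big1 // => u _; case uv: (arc u v) => //; case ru: (ret u) => //.
  by rewrite (stc_one_component H ru uv) in lv.
have [d _] := leaf_deg H lv; rewrite (bigD1 (pa E v)) //= pa_arc ?d // big1 => [|u].
  by rewrite addn0; case: (ret _).
by case uv: (arc u v) => //; rewrite -(pa_uniq _ uv) ?d // eqxx.
Qed.

Lemma sum_ret_le : \sum_v ret v < n.
Proof. by have := sum_branch; lia. Qed.

Definition special v := [|| v == o, is_branch E v | base_leaf v].

(** The three kinds contribute [1], [n - r - 1] and [n - r]. *)
Lemma sum_special : \sum_v special v <= 2 * (n - \sum_v ret v).
Proof.
have /leq_trans : \sum_v special v <= \sum_v ((v == o) + (is_branch E v + base_leaf v)).
  apply: leq_sum => v _; rewrite /special.
  by case: (v == o); case: (is_branch E v); case: (base_leaf v).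
apply; rewrite !big_split /=.
have -> : \sum_v (v == o) = 1.
  by rewrite (bigD1 o) //= eqxx big1 // => v /negbTE ->.
have := sum_branch; have := sum_base_leaf.
by move: (\sum_v is_branch E v) (\sum_v ret v) (\sum_v base_leaf v) => a b c; lia.
Qed.

(* Above a base leaf there are no reticulations, hence the ancestors of a base
   leaf form a chain. *)
Lemma ancestors_chain a c c' : ~~ ret a -> ~~ ret (pa E a) ->
  connect arc c a -> connect arc c' a -> connect arc c c' || connect arc c' c.
Proof.
have [k] := ubnP (rank E a); elim: k a => // k IH a; rewrite ltnS => hk ra rp ca ca'.
have step d : connect arc d a -> d = a \/ arc (pa E a) a /\ connect arc d (pa E a).
  case/connectP => p; elim/last_ind: p => [|p x _] /=; first by move=> _ ->; left.
  rewrite rcons_path last_rcons => /andP[dp xa] ea; subst x; right.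
  have e := nret_pa H ra xa.
  by rewrite -e xa; split => //; apply/connectP; exists p.
have [->|[pc cp]] := step _ ca; first by rewrite ca' orbT.
have [->|[_ cp']] := step _ ca'; first by rewrite ca.
apply: (IH (pa E a)) => //.
  exact: leq_trans (rank_arc H pc) hk.
case: (kindP H (pa E a)) => h.
(* The root has no parent, so [pa] returns the root itself, which is not a reticulation. *)
- rewrite h /pa; case: pickP => [u|_] /=; last by rewrite (root_ret H).
  by rewrite (arc_root H).
- by rewrite (leaf_arc H) in pc.
- by apply: (par_tree H _ h); apply: pa_arc; case: (tree_deg h) => ->.
- by rewrite h in rp.
Qed.

(** If both children were above [a], one would lie below the other by [ancestors_chain]; the path
    between them would enter its end through the only parent [b], closing a directed cycle. *)
Lemma branch_disjoint b c c' a : arc b c -> arc b c' -> c != c' -> ~~ ret c -> ~~ ret c' ->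
  base_leaf a -> ~~ (connect arc c a && connect arc c' a).
Proof.
move=> bc bc' cc rc rc' /andP[la ra]; apply/negP => /andP[ca ca'].
have key d d' : arc b d -> arc b d' -> d != d' -> ~~ ret d' -> connect arc d d' -> False.
  move=> bd bd' dd rd' /connectP[p]; elim/last_ind: p => [|p x _] /=.
    by move=> _ e; rewrite e eqxx in dd.
  rewrite rcons_path last_rcons => /andP[dp xa] ea; subst x.
  have e := nret_uniq H rd' xa bd'.
  have := arc_connectN H bd; suff -> : connect arc d b by [].
  by apply/connectP; exists p.
have na : ~~ ret a by rewrite (leaf_ret H).
case/orP: (ancestors_chain na ra ca ca') => h; apply: (key _ _ _ _ _ _ h) => //.
by rewrite eq_sym.
Qed.

End Counting.

(** * Isomorphisms and exchange of two arcs *)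

(** The relation [net_iso] over arbitrary finite vertex types, so that modified graphs need not live
    on an initial segment of [nat]. *)
Definition giso (n : nat) (V V' : finType) (E : {set V * V}) (E' : {set V' * V'})
    (lab : {ffun 'I_n -> V}) (lab' : {ffun 'I_n -> V'}) (f : V -> V') : Prop :=
  [/\ bijective f,
      forall u v, arcrel E' (f u) (f v) = arcrel E u v
    & forall i, f (lab i) = lab' i].

Section Invariance.
Variables (V V' : finType) (E : {set V * V}) (E' : {set V' * V'}) (f : V -> V').
Hypothesis fb : bijective f.
Hypothesis fE : forall u v, arcrel E' (f u) (f v) = arcrel E u v.

Lemma iso_indeg v : indeg E' (f v) = indeg E v.
Proof.
rewrite !indeg_sum (reindex f) /=; last exact: onW_bij.
by apply: eq_bigr => u _; rewrite fE.
Qed.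

Lemma iso_outdeg v : outdeg E' (f v) = outdeg E v.
Proof.
rewrite !outdeg_sum (reindex f) /=; last exact: onW_bij.
by apply: eq_bigr => u _; rewrite fE.
Qed.

Lemma iso_deg v d : has_degree E' (f v) d = has_degree E v d.
Proof. by rewrite /has_degree iso_indeg iso_outdeg. Qed.

Lemma iso_tree v : is_tree E' (f v) = is_tree E v. Proof. exact: iso_deg. Qed.
Lemma iso_ret v : is_ret E' (f v) = is_ret E v. Proof. exact: iso_deg. Qed.

Lemma iso_branch v : is_branch E' (f v) = is_branch E v.
Proof.
rewrite /is_branch iso_tree; congr (_ && _).
have [g fK gK] := fb.
apply/forallP/forallP => h c; first by have := h (f c); rewrite fE iso_ret.
by rewrite -(gK c) fE iso_ret.
Qed.

Lemma iso_sum_ret : \sum_v is_ret E' v = \sum_v is_ret E v.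
Proof.
rewrite (reindex f) /=; last exact: onW_bij.
by apply: eq_bigr => u _; rewrite iso_ret.
Qed.

Lemma iso_leaf n (lab : {ffun 'I_n -> V}) (lab' : {ffun 'I_n -> V'}) v :
  (forall i, f (lab i) = lab' i) -> is_leaf lab' (f v) = is_leaf lab v.
Proof.
move=> fl; apply/codomP/codomP => -[i]; last by move=> ->; exists i.
by rewrite -fl => /(bij_inj fb) ->; exists i.
Qed.

End Invariance.

Lemma giso_id n (V : finType) (E : {set V * V}) (lab : {ffun 'I_n -> V}) :
  giso E E lab lab id.
Proof. by split => //; exists id. Qed.

Lemma giso_comp n (V1 V2 V3 : finType) E1 E2 E3 (l1 : {ffun 'I_n -> V1})
    (l2 : {ffun 'I_n -> V2}) (l3 : {ffun 'I_n -> V3}) f g :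
  giso E1 E2 l1 l2 f -> giso E2 E3 l2 l3 g -> giso E1 E3 l1 l3 (g \o f).
Proof.
move=> [fb fE fl] [gb gE gl]; split; first exact: bij_comp.
  by move=> u v /=; rewrite gE fE.
by move=> i /=; rewrite fl gl.
Qed.

Lemma giso_inv n (V1 V2 : finType) E1 E2 (l1 : {ffun 'I_n -> V1})
    (l2 : {ffun 'I_n -> V2}) f : giso E1 E2 l1 l2 f ->
  exists g, [/\ cancel f g, cancel g f & giso E2 E1 l2 l1 g].
Proof.
move=> [[g fK gK] fE fl]; exists g; split => //; split; first by exists f.
  by move=> u v; rewrite -fE !gK.
by move=> i; rewrite -fl fK.
Qed.

(* A vertex is determined by any of its non-reticulation children, and
   following such children leads to a leaf. *)
Lemma rigid n (V : finType) (E : {set V * V}) o (lab : {ffun 'I_n -> V}) f :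
  simplex_tree_child E o lab -> giso E E lab lab f -> f =1 id.
Proof.
move=> H [fb fE fl] v; have [k] := ubnP (#|V| - rank E v).
elim: k v => // k IH v; rewrite ltnS => hk.
have [/codomP[i ->]|lv] := boolP (is_leaf lab v); first exact: fl.
have [w vw kw] := stc_tree_child H lv.
have rw : ~~ is_ret E w by case/orP: kw => [/tree_ret|/(leaf_ret H)] ->.
have fw : f w = w.
  apply: IH; apply: leq_trans hk; have := rank_arc H vw.
  by have := rank_lt E w; rewrite ltnS; lia.
by apply: (nret_uniq H rw _ vw); rewrite -[X in arcrel _ _ X]fw fE.
Qed.

Lemma iso_root n (V V' : finType) (E : {set V * V}) (E' : {set V' * V'}) o o'
    (lab : {ffun 'I_n -> V}) (lab' : {ffun 'I_n -> V'}) f :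
  simplex_tree_child E o lab -> simplex_tree_child E' o' lab' ->
  giso E E' lab lab' f -> f o = o'.
Proof.
move=> H H' [fb fE _]; apply/eqP.
by rewrite (root_indeg0 H') (iso_indeg fb fE) -(root_indeg0 H).
Qed.

Lemma network_of_graph n (V : finType) (E : {set V * V}) o (lab : {ffun 'I_n -> V}) :
  simplex_tree_child E o lab ->
  exists (N : network n) f, giso E (net_arcs N) lab (net_label N) f.
Proof.
move=> H.
pose E' : {set 'I_#|V| * 'I_#|V|} :=
  [set e | (enum_val e.1, enum_val e.2) \in E].
pose lab' : {ffun 'I_n -> 'I_#|V|} := [ffun i => enum_rank (lab i)].
have fb : bijective (@enum_rank V) by exact: enum_rank_bij.
have fE u v : arcrel E' (enum_rank u) (enum_rank v) = arcrel E u v.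
  by rewrite /arcrel inE /= !enum_rankK.
have fl i : enum_rank (lab i) = lab' i by rewrite ffunE.
have sur (v : 'I_#|V|) : exists u, v = enum_rank u by exists (enum_val v); rewrite enum_valK.
have H' : simplex_tree_child E' (enum_rank o) lab'.
  apply: (simplex_tree_child_of_rank (h := fun v => rank E (enum_val v))).
  - move=> u v; have [[{}u ->] [{}v ->]] := (sur u, sur v).
    by rewrite fE !enum_rankK; apply: (rank_arc H).
  - by rewrite (iso_deg fb fE); apply: (stc_root H).
  - by move=> i j; rewrite -!fl => /(bij_inj fb); apply: (stc_label_inj H).
  - move=> v; have [{}v ->] := sur v.
    by rewrite (iso_leaf fb _ fl) (iso_deg fb fE); apply: (stc_leaf H).
  - move=> v; have [{}v ->] := sur v.
    rewrite (iso_leaf fb _ fl) (iso_tree fb fE) (iso_ret fb fE) (inj_eq (bij_inj fb)).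
    exact: (stc_inner H).
  - move=> v; have [{}v ->] := sur v; rewrite (iso_leaf fb _ fl) => /(stc_tree_child H)[w vw kw].
    by exists (enum_rank w); rewrite ?fE // (iso_tree fb fE) (iso_leaf fb _ fl).
  - move=> v w; have [[{}v ->] [{}w ->]] := (sur v, sur w).
    by rewrite fE (iso_ret fb fE) (iso_leaf fb _ fl); apply: (stc_one_component H).
by exists (Network H'), enum_rank.
Qed.

Section Swap.
Variable V : finType.

(* Exchanges the heads of the arcs [(x1, y1)] and [(x2, y2)]. *)
Definition swap (E : {set V * V}) (x1 y1 x2 y2 : V) : {set V * V} :=
  [set e | (e.1, if (e.1 == x1) || (e.1 == x2) then tperm y1 y2 e.2 else e.2) \in E].

Lemma swapE E x1 y1 x2 y2 u v : arcrel (swap E x1 y1 x2 y2) u v =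
  arcrel E u (if (u == x1) || (u == x2) then tperm y1 y2 v else v).
Proof. by rewrite /arcrel inE. Qed.

Lemma swapK E x1 y1 x2 y2 : swap (swap E x1 y1 x2 y2) x1 y2 x2 y1 = E.
Proof.
apply/setP => -[u v]; rewrite !inE /=.
by case e: (_ || _); rewrite // tpermC tpermK.
Qed.

Lemma swap_iso (V' : finType) (E : {set V * V}) (E' : {set V' * V'}) (f : V -> V')
    (swap' : {set V' * V'}) x1 y1 x2 y2 : bijective f ->
  (forall u v, arcrel E' (f u) (f v) = arcrel E u v) ->
  (forall u v, arcrel swap' u v = arcrel E' u
     (if (u == f x1) || (u == f x2) then tperm (f y1) (f y2) v else v)) ->
  forall u v, arcrel swap' (f u) (f v) = arcrel (swap E x1 y1 x2 y2) u v.
Proof.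
move=> fb fE sE u v; rewrite sE swapE !(inj_eq (bij_inj fb)).
case: ifP => _; last exact: fE.
by rewrite -inj_tperm ?fE //; apply: bij_inj.
Qed.

Variables (n : nat) (E : {set V * V}) (o : V) (lab : {ffun 'I_n -> V}).
Hypothesis H : simplex_tree_child E o lab.
Variables x1 y1 x2 y2 : V.
Hypotheses (a1 : arcrel E x1 y1) (a2 : arcrel E x2 y2).
(** [na1] and [na2] exclude doubled arcs; equal tails are allowed and leave [E] unchanged. [rx1],
    [rx2] and [ry] preserve one-component and tree-child, [nc1] and [nc2] acyclicity. *)
Hypotheses (na1 : (x1 == x2) || ~~ arcrel E x1 y2) (na2 : (x1 == x2) || ~~ arcrel E x2 y1).
Hypotheses (rx1 : ~~ is_ret E x1) (rx2 : ~~ is_ret E x2).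
Hypothesis ry : is_ret E y1 = is_ret E y2.
Hypotheses (nc1 : ~~ connect (arcrel E) y1 x2) (nc2 : ~~ connect (arcrel E) y2 x1).

Notation E' := (swap E x1 y1 x2 y2).

Lemma swap_outdeg v : outdeg E' v = outdeg E v.
Proof.
rewrite !outdeg_sum; case e: ((v == x1) || (v == x2)); last first.
  by apply: eq_bigr => u _; rewrite swapE e.
rewrite [RHS](reindex_inj (@perm_inj _ (tperm y1 y2))).
by apply: eq_bigr => u _; rewrite swapE e.
Qed.

Lemma swap_indeg v : indeg E' v = indeg E v.
Proof.
rewrite !indeg_sum; have [e|ne] := eqVneq x1 x2.
  apply: eq_bigr => u _; rewrite swapE e orbb.
  have [->|//] := eqVneq u x2; congr (nat_of_bool _).
  by case: tpermP => [->|->|//]; rewrite a2 -e a1.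
move: na1 na2; rewrite (negbTE ne) /= => n1 n2.
rewrite (bigD1 x1) //= [RHS](bigD1 x1) //= (bigD1 x2) 1?eq_sym //=.
rewrite [in RHS](bigD1 x2) 1?eq_sym //= !addnA !swapE !eqxx orbT /=; congr (_ + _).
  case: tpermP => [->|->|//]; rewrite a1 a2.
    by rewrite (negbTE n1) (negbTE n2).
  by rewrite (negbTE n1) (negbTE n2).
by apply: eq_bigr => u /andP[/negbTE u1 /negbTE u2]; rewrite swapE u1 u2.
Qed.

Lemma swap_deg v d : has_degree E' v d = has_degree E v d.
Proof. by rewrite /has_degree swap_indeg swap_outdeg. Qed.

Lemma nret_kind u v : arcrel E u v -> (is_tree E v || is_leaf lab v) = ~~ is_ret E v.
Proof.
move=> uv; case: (kindP H v) => h.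
- by move: uv; rewrite h (arc_root H).
- by rewrite h orbT (leaf_ret H).
- by rewrite h (tree_ret h).
- by rewrite h (ret_tree h) (ret_leaf H h).
Qed.

Lemma swap_simplex_tree_child : simplex_tree_child E' o lab.
Proof.
pose M := #|V|.+1.
(* Vertices below [y1] or [y2] are raised by [M], which exceeds every old rank. Neither tail is
   below either head, so the new arcs increase [h], and the old ones still do. *)
pose h v := rank E v + (M * connect (arcrel E) y1 v + M * connect (arcrel E) y2 v).
have c11 := arc_connectN H a1; have c22 := arc_connectN H a2.
have mono u v : connect (arcrel E) u v -> connect (arcrel E) y1 u <= connect (arcrel E) y1 v /\
    connect (arcrel E) y2 u <= connect (arcrel E) y2 v.
  by move=> uv; split; case c: (connect _ _ u) => //; rewrite (connect_trans c uv).
have hM v y : v \in [:: x1; x2] -> y \in [:: y1; y2] -> h v < h y.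
  move=> hv hy; have /leq_trans : h v < M.
    rewrite /h; move: hv; rewrite !inE => /orP[] /eqP->.
      by rewrite c11 (negbTE nc2) !muln0 !addn0 rank_lt.
    by rewrite (negbTE nc1) c22 !muln0 !addn0 rank_lt.
  apply; rewrite /h; move: hy; rewrite !inE => /orP[] /eqP->; rewrite connect0 muln1.
    by rewrite addnCA leq_addr.
  by rewrite addnA leq_addl.
apply: (simplex_tree_child_of_rank (h := h)).
- move=> u v; rewrite swapE.
  have old : arcrel E u v -> h u < h v.
    move=> uv; have [m1 m2] := mono _ _ (connect1 uv).
    by rewrite /h -addSn !leq_add ?(rank_arc H) // leq_mul2l ?m1 ?m2 orbT.
  case: ifP => // ux; have {}ux : u \in [:: x1; x2] by rewrite !inE.
  by case: tpermP => [->|->|_ _ /old //] _; apply: hM; rewrite // !inE eqxx ?orbT.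
- by rewrite swap_deg; apply: (stc_root H).
- exact: (stc_label_inj H).
- by move=> v lv; rewrite swap_deg; apply: (stc_leaf H lv).
- by move=> v vo lv; rewrite /is_tree /is_ret !swap_deg; apply: (stc_inner H vo lv).
- move=> v lv; have [w vw kw] := stc_tree_child H lv.
  have kt : is_tree E (tperm y1 y2 w) || is_leaf lab (tperm y1 y2 w).
    move: kw; rewrite (nret_kind vw); case: tpermP => [->|->|_ _].
    + by rewrite (nret_kind a2) ry.
    + by rewrite (nret_kind a1) ry.
    + by rewrite (nret_kind vw).
  exists (if (v == x1) || (v == x2) then tperm y1 y2 w else w).
    by rewrite swapE; case: (_ || _); rewrite // tpermK.
  by case: ifP => _; rewrite /is_tree swap_deg.
- move=> v w; rewrite /is_ret swap_deg => rv; rewrite swapE.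
  case: ifP => [/orP[]/eqP e|_]; last exact: (stc_one_component H rv).
    by move: rx1; rewrite -e [is_ret _ _]rv.
  by move: rx2; rewrite -e [is_ret _ _]rv.
Qed.

End Swap.

(** * Adding a reticulation above a leaf *)

Section AddReticulation.
Variable V : finType.

Notation w := (inr true : V + bool).
Notation rho := (inr false : V + bool).

(* Subdivides the arc [(x, v)] by a new vertex [w], and the arc [(b, a)] by a
   new vertex [rho], and adds an arc from [w] to [rho]. *)
Definition add_ret_arc (E : {set V * V}) (b a x v : V) (s t : V + bool) : bool :=
  match s, t with
  | inl s, inl t => [&& arcrel E s t, (s, t) != (b, a) & (s, t) != (x, v)]
  | inl s, inr true => s == x
  | inl s, inr false => s == b
  | inr true, inl t => t == v
  | inr false, inl t => t == a
  | inr true, inr false => true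
  | _, _ => false
  end.

Definition add_ret (E : {set V * V}) (b a x v : V) : {set (V + bool) * (V + bool)} :=
  [set e | add_ret_arc E b a x v e.1 e.2].

Lemma add_retE E b a x v s t : arcrel (add_ret E b a x v) s t = add_ret_arc E b a x v s t.
Proof. by rewrite /arcrel inE. Qed.

Variables (n : nat) (E : {set V * V}) (o : V) (lab : {ffun 'I_n -> V}).
Hypothesis H : simplex_tree_child E o lab.
Variables b a x v : V.
Hypotheses (ba : arcrel E b a) (la : is_leaf lab a) (bb : is_branch E b).
Hypotheses (xv : arcrel E x v) (tv : is_tree E v).

Notation E' := (add_ret E b a x v).
Notation arc' := (add_ret_arc E b a x v).

Definition add_ret_label : {ffun 'I_n -> V + bool} := [ffun i => inl (lab i)].

(** The two subdivided arcs reappear as the paths through [w] and [rho], so [E] can be read off the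
    enlarged graph once these vertices are marked. *)
Lemma add_ret_restore s t : arcrel E s t =
  [|| arc' (inl s) (inl t), arc' (inl s) w && arc' w (inl t)
    | arc' (inl s) rho && arc' rho (inl t)].
Proof.
rewrite /= -!xpair_eqE.
have [[-> ->]|_] := eqVneq (s, t) (b, a); first by rewrite ba !orbT.
have [[-> ->]|_] := eqVneq (s, t) (x, v); first by rewrite xv !orbT.
by rewrite !andbT !orbF.
Qed.

(** The subdivided arcs are distinct since [v] is a tree vertex and [a] a leaf; each old arc thus
    survives in exactly one form, which preserves the degrees. *)
Lemma add_ret_split_arc s t : arcrel E s t =
  arc' (inl s) (inl t) + ((s == x) * (t == v) + (s == b) * (t == a)) :> nat.
Proof.
have va : (v == a) = false by apply/eqP => e; move: tv; rewrite e (leaf_tree H la).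
rewrite /= !mulnb -!xpair_eqE.
have [[-> ->]|_] := eqVneq (s, t) (b, a).
  by rewrite ba xpair_eqE [a == v]eq_sym va andbF.
by have [[-> ->]|_] := eqVneq (s, t) (x, v); rewrite ?xv //= ?andbT ?addn0.
Qed.

Lemma sum_eq1 (c : V) : \sum_u (u == c) = 1.
Proof. by rewrite (bigD1 c) //= eqxx big1 // => u /negbTE ->. Qed.

Lemma add_ret_indeg t : indeg E' (inl t) = indeg E t.
Proof.
rewrite !indeg_sum big_sumType /= big_bool.
rewrite !add_retE /= [RHS](eq_bigr _ (fun s _ => add_ret_split_arc s t)) !big_split /=.
rewrite -!big_distrl /= !sum_eq1 !mul1n; congr (_ + _).
by apply: eq_bigr => s _; rewrite add_retE.
Qed.

Lemma add_ret_outdeg s : outdeg E' (inl s) = outdeg E s.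
Proof.
rewrite !outdeg_sum big_sumType /= big_bool.
rewrite !add_retE /= [RHS](eq_bigr _ (fun t _ => add_ret_split_arc s t)) !big_split /=.
rewrite -!big_distrr /= !sum_eq1 !muln1; congr (_ + _).
by apply: eq_bigr => t _; rewrite add_retE.
Qed.

Lemma add_ret_deg t d : has_degree E' (inl t) d = has_degree E t d.
Proof. by rewrite /has_degree add_ret_indeg add_ret_outdeg. Qed.

Lemma add_ret_tree_w : is_tree E' w.
Proof.
apply/has_degreeP; rewrite indeg_sum outdeg_sum !big_sumType /= !big_bool !add_retE /=.
have -> : \sum_i arcrel E' (inl i) w = 1.
  by rewrite -(sum_eq1 x); apply: eq_bigr => i _; rewrite add_retE.
have -> : \sum_i arcrel E' w (inl i) = 1.
  by rewrite -(sum_eq1 v); apply: eq_bigr => i _; rewrite add_retE.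
by [].
Qed.

Lemma add_ret_ret_rho : is_ret E' rho.
Proof.
apply/has_degreeP; rewrite indeg_sum outdeg_sum !big_sumType /= !big_bool !add_retE /=.
have -> : \sum_i arcrel E' (inl i) rho = 1.
  by rewrite -(sum_eq1 b); apply: eq_bigr => i _; rewrite add_retE.
have -> : \sum_i arcrel E' rho (inl i) = 1.
  by rewrite -(sum_eq1 a); apply: eq_bigr => i _; rewrite add_retE.
by [].
Qed.

Lemma add_ret_leaf t : is_leaf add_ret_label (inl t) = is_leaf lab t.
Proof.
apply/codomP/codomP => -[i e]; exists i; last by rewrite ffunE e.
by move: e; rewrite ffunE => -[].
Qed.

Lemma add_ret_leafN c : is_leaf add_ret_label (inr c) = false.
Proof. by apply/codomP => -[i]; rewrite ffunE. Qed.

Lemma add_ret_simplex_tree_child : simplex_tree_child E' (inl o) add_ret_label.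
Proof.
have va : v != a by apply/eqP => e; move: tv; rewrite e (leaf_tree H la).
have xa : x != a by apply/eqP => e; move: xv; rewrite e (leaf_arc H _ la).
have [tb /forallP br] := andP bb.
have bna : b != a by apply/eqP => e; rewrite e (leaf_tree H la) in tb.
pose M := #|V|.+1.
(* Doubling the ranks makes room for [w] just above [x]; [rho] and then [a] go above everything, so
   the arc from [w] to [rho] is increasing wherever [w] is inserted. *)
pose h (s : V + bool) := match s with
  | inl s => if s == a then 2 * M + 2 else 2 * rank E s
  | inr true => 2 * rank E x + 1
  | inr false => 2 * M + 1 end.
have hM t : rank E t < M := rank_lt E t.
apply: (simplex_tree_child_of_rank (h := h)).
- move=> [s|[]] [t|[]]; rewrite add_retE //=.
  + case/andP=> st _; have [e|_] := eqVneq s a; first by rewrite e (leaf_arc H _ la) in st.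
    have := rank_arc H st; have := hM s; case: ifP => _; lia.
  + by move=> /eqP ->; rewrite (negbTE xa); lia.
  + by move=> /eqP ->; rewrite (negbTE bna); have := hM b; lia.
  + by move=> /eqP ->; rewrite (negbTE va); have := rank_arc H xv; lia.
  + by have := hM x; lia.
  + by move=> /eqP ->; rewrite eqxx; lia.
- by rewrite add_ret_deg; apply: (stc_root H).
- by move=> i j; rewrite !ffunE => -[] /(stc_label_inj H).
- move=> [t|c]; last by rewrite add_ret_leafN.
  by rewrite add_ret_leaf add_ret_deg; apply: (stc_leaf H).
- move=> [t|[]] no; last 2 first.
  + by rewrite add_ret_tree_w.
  + by rewrite add_ret_ret_rho orbT.
  rewrite add_ret_leaf /is_tree /is_ret !add_ret_deg; apply: (stc_inner H).
  by apply: contraNneq no => ->.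
- move=> [t|[]]; last 2 first.
  + by exists (inl v); rewrite ?add_retE //= ?eqxx // /is_tree add_ret_deg [has_degree _ _ _]tv.
  + by exists (inl a); rewrite ?add_retE //= ?eqxx // add_ret_leaf la orbT.
  rewrite add_ret_leaf => /(stc_tree_child H)[c tc kc].
  have key c' : arcrel E t c' -> (t, c') != (b, a) -> is_tree E c' || is_leaf lab c' ->
    exists2 w, arcrel E' (inl t) w & is_tree E' w || is_leaf add_ret_label w.
    move=> tc' ne kc'; have [[e1 e2]|ne'] := eqVneq (t, c') (x, v).
      by exists w; rewrite ?add_ret_tree_w // add_retE /= e1.
    exists (inl c'); first by rewrite add_retE /= tc' ne ne'.
    by rewrite add_ret_leaf /is_tree add_ret_deg.
  have [[e1 e2]|ne] := eqVneq (t, c) (b, a); last exact: key kc.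
  (* The child [a] has moved below [rho]; the other child of the branch vertex [b] replaces it. *)
  have [|c' bc' ca'] := outdeg2_other _ ba; first by case: (tree_deg tb).
  have := br c'; rewrite bc' /= -(nret_kind H bc') => kc'.
  by rewrite e1 in key *; apply: (key c') => //; rewrite xpair_eqE eqxx.
- move=> [s|[]] [t|[]]; rewrite ?add_retE //=.
  + rewrite /is_ret add_ret_deg add_ret_leaf => rs /andP[st _].
    exact: (stc_one_component H rs).
  + rewrite /is_ret add_ret_deg => rs /eqP e; rewrite e in rs.
    by have := stc_one_component H rs xv; rewrite (tree_leaf H tv).
  + rewrite /is_ret add_ret_deg => rs /eqP e; rewrite e in rs.
    by rewrite (ret_tree rs) in tb.
  + by rewrite (tree_ret add_ret_tree_w).
  + by rewrite (tree_ret add_ret_tree_w).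
  + by move=> _ /eqP ->; rewrite add_ret_leaf.
Qed.

End AddReticulation.

(** * Double counting over isomorphism classes *)

Section Representatives.
Variable n : nat.

(** A partial inverse of [net_enc] makes [network n] itself a finite type, so that sums over
    networks make sense. *)
Definition net_dec (c : net_code n) : option (network n) :=
  if pselect (exists N : network n, net_enc N = c) is left h then Some (projT1 (cid h))
  else None.

Lemma net_encK : pcancel (@net_enc n) net_dec.
Proof.
move=> N; rewrite /net_dec; case: pselect => [h|]; last by case; exists N.
by congr Some; apply: net_enc_inj; case: (cid h).
Qed.

End Representatives.

HB.instance Definition _ n := Finite.copy (network n) (pcan_type (@net_encK n)).

(** Two pairs of vertices: the two arcs to be exchanged or subdivided. *)
Definition mark (m : nat) : Type := (('I_m * 'I_m) * ('I_m * 'I_m))%type.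
HB.instance Definition _ m := Finite.on (mark m).

Definition map_mark (V W : Type) (f : V -> W) (e : (V * V) * (V * V)) :
    (W * W) * (W * W) :=
  ((f e.1.1, f e.1.2), (f e.2.1, f e.2.2)).

Lemma map_mark_id (V : Type) (f : V -> V) e : f =1 id -> map_mark f e = e.
Proof. by move=> h; case: e => [[a b] [c d]]; rewrite /map_mark /= !h. Qed.

Section Marked.
Variable n : nat.

Lemma net_iso_refl (N : network n) : net_iso N N.
Proof. by exists id; apply: giso_id. Qed.

Lemma net_iso_sym (N M : network n) : net_iso N M -> net_iso M N.
Proof. by case=> f /giso_inv[g [_ _ ?]]; exists g. Qed.

Lemma net_iso_trans (N M K : network n) : net_iso N M -> net_iso M K -> net_iso N K.
Proof. by case=> f hf [g hg]; exists (g \o f); apply: giso_comp hf hg. Qed.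

Definition canon (N : network n) : network n :=
  odflt N [pick M | `[< net_iso N M >]].

Lemma canon_iso N : net_iso N (canon N).
Proof.
rewrite /canon; case: pickP => [M /asboolP//|h].
exact: net_iso_refl.
Qed.

Lemma canon_eq N M : net_iso N M -> canon N = canon M.
Proof.
move=> NM; rewrite /canon.
have e : (fun K => `[< net_iso N K >]) =1 (fun K => `[< net_iso M K >]).
  move=> K; apply/asboolP/asboolP => h; last exact: net_iso_trans NM h.
  exact: net_iso_trans (net_iso_sym NM) h.
rewrite (eq_pick e); case: pickP => //= h.
by have /asboolP[] := h M; apply: net_iso_refl.
Qed.

Definition reps : {set network n} := [set N | canon N == N].

Lemma canon_reps N : canon N \in reps.
Proof. by rewrite inE; apply/eqP/esym/canon_eq/canon_iso. Qed.

Lemma reps_iso N M : N \in reps -> M \in reps -> net_iso N M -> N = M.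
Proof. by rewrite !inE => /eqP<- /eqP<- /canon_eq; rewrite -!(canon_eq (canon_iso _)). Qed.

Definition mnet := {N : network n & mark (net_order N)}.

Definition miso (x y : mnet) : Prop :=
  exists2 f, giso (net_arcs (tag x)) (net_arcs (tag y)) (net_label (tag x)) (net_label (tag y)) f
  & map_mark f (tagged x) = tagged y.

Lemma miso_sym x y : miso x y -> miso y x.
Proof.
case=> f /giso_inv[g [fK gK hg]] e; exists g => //.
by case: (tagged x) e => [[? ?] [? ?]] <-; rewrite /map_mark /= !fK.
Qed.

Lemma miso_trans x y z : miso x y -> miso y z -> miso x z.
Proof.
case=> f hf e [g hg e']; exists (g \o f); first exact: giso_comp hf hg.
by rewrite -e' -e.
Qed.

Lemma miso_canon (x : mnet) : exists y : mnet, (tag y \in reps) /\ miso x y.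
Proof.
have [f hf] := canon_iso (tag x).
exists (existT (fun N => mark (net_order N)) (canon (tag x)) (map_mark f (tagged x))).
by split; [apply: canon_reps|exists f].
Qed.

(** Between representatives an isomorphism is an automorphism, hence the identity by [rigid]; marks
    on representatives are thus the isomorphism classes of marked networks. *)
Lemma miso_reps x y : tag x \in reps -> tag y \in reps -> miso x y -> x = y.
Proof.
case: x y => [N e] [M e'] /= rN rM [f hf /= ef].
have NM : N = M by apply: reps_iso => //; exists f.
subst M; congr existT; rewrite -ef.
have /= fid := rigid (network_axiom N) hf.
by rewrite map_mark_id.
Qed.

Definition cnt (Phi : mnet -> Prop) (N : network n) : nat :=
  #|[set e : mark (net_order N) | `[< Phi (existT _ N e) >]]|.

Lemma sum_cnt Phi : \sum_(N in reps) cnt Phi N =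
  #|[set x : mnet | (tag x \in reps) && `[< Phi x >]]|.
Proof.
under eq_bigr => N _ do rewrite /cnt -sum1_card.
rewrite (sig_big_dep (fun N : network n => N \in reps)) -sum1_card /=.
apply: eq_big => // -[N e]; rewrite !inE //=.
Qed.

(* Double counting up to isomorphism: isomorphisms fix marks of representatives
   by rigidity, so a relation reflecting isomorphism is injective on them. *)
Lemma rep_count (Phi Psi : mnet -> Prop) (Rel : mnet -> mnet -> Prop) :
  (forall x, Phi x -> exists2 y, Psi y & Rel x y) ->
  (forall x y, miso x y -> Psi x -> Psi y) ->
  (forall x x' y y', Rel x y -> Rel x' y' -> miso y y' -> miso x x') ->
  \sum_(N in reps) cnt Phi N <= \sum_(N in reps) cnt Psi N.
Proof.
move=> ex inv refl; rewrite !sum_cnt.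
have {}ex (x : mnet) : exists z, Phi x ->
    [/\ tag z \in reps, Psi z & exists2 y, Rel x y & miso y z].
  have [px|px] := pselect (Phi x); last by exists x.
  have [y py xy] := ex x px; have [z [rz yz]] := miso_canon y.
  by exists z => _; split=> //; [apply: (inv _ _ yz py)|exists y].
have [F HF] := choice ex.
set A := finset _; set B := finset _.
have Finj : {in A &, injective F}.
  move=> x x'; rewrite !inE => /andP[rx /asboolP px] /andP[rx' /asboolP px'] e.
  have [_ _ [y xy yz]] := HF x px; have [_ _ [y' xy' yz']] := HF x' px'.
  apply: miso_reps; rewrite ?inE //; apply: (refl _ _ _ _ xy xy'); apply: miso_trans yz _.
  by rewrite e; apply: miso_sym.
rewrite -(card_in_imset Finj); apply/subset_leq_card/fintype.subsetP => z /imsetP[x].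
rewrite !inE => /andP[rx /asboolP px] ->.
have [] := HF x px; rewrite inE => -> pz _; exact/asboolP.
Qed.

End Marked.

(** * Networks with few reticulations *)

Lemma card_le_inj (T T' : finType) (A : {set T}) (B : {set T'}) (f : T -> T') :
  {in A, forall x, f x \in B} -> {in A &, injective f} -> #|A| <= #|B|.
Proof.
move=> fAB finj; rewrite -(card_in_imset finj).
by apply/subset_leq_card/fintype.subsetP => z /imsetP[x xA ->]; apply: fAB.
Qed.

Definition kret n (N : network n) := \sum_v is_ret (net_arcs N) v.

Lemma kretE n (N : network n) : kret N = #|reticulations N|.
Proof. by rewrite card_set_sum. Qed.

Definition leaf_of_branch n (N : network n) :=
  [set e : 'I_(net_order N) * 'I_(net_order N) | [&& arcrel (net_arcs N) e.1 e.2,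
    is_leaf (net_label N) e.2 & is_branch (net_arcs N) e.1]].

Section SwapRelation.
Variable n : nat.

(** The marks of [y] are the two new arcs, and exchanging them back recovers [x] ([swapK]). *)
Definition swap_rel (x y : mnet n) : Prop :=
  let e := tagged x in
  exists2 f, giso (swap (net_arcs (tag x)) e.1.1 e.1.2 e.2.1 e.2.2) (net_arcs (tag y))
                  (net_label (tag x)) (net_label (tag y)) f
    & tagged y = map_mark f ((e.1.1, e.2.2), (e.2.1, e.1.2)).

Lemma swap_rel_reflect x x' y y' :
  swap_rel x y -> swap_rel x' y' -> miso y y' -> miso x x'.
Proof.
case: x x' => [N [[x1 y1] [x2 y2]]] [N' [[x1' y1'] [x2' y2']]].
rewrite /swap_rel /= => -[f hf ef] [f' /giso_inv[g' [f'K g'K hg']] ef'] [h hh].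
rewrite ef ef' /map_mark /= => -[e1 e2 e3 e4].
exists (g' \o (h \o f)); last by rewrite /map_mark /= e1 e2 e3 e4 !f'K.
have [kb kE kl] := giso_comp (giso_comp hf hh) hg'.
split=> // u v; have k1 : (g' \o (h \o f)) x1 = x1' by rewrite /= e1 f'K.
have k2 : (g' \o (h \o f)) x2 = x2' by rewrite /= e3 f'K.
have k3 : (g' \o (h \o f)) y1 = y1' by rewrite /= e4 f'K.
have k4 : (g' \o (h \o f)) y2 = y2' by rewrite /= e2 f'K.
rewrite -(swapK (net_arcs N) x1 y1 x2 y2).
apply: (swap_iso kb kE) => s t; rewrite k1 k2 k3 k4 swapE /=.
by case e: (_ || _); rewrite // tpermC tpermK.
Qed.

Lemma swap_rel_ex (N : network n) (x1 y1 x2 y2 : 'I_(net_order N)) :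
  simplex_tree_child (swap (net_arcs N) x1 y1 x2 y2) (net_root N) (net_label N) ->
  exists y, swap_rel (existT _ N ((x1, y1), (x2, y2))) y /\
    exists M : simplex_tree_child (swap (net_arcs N) x1 y1 x2 y2) (net_root N) (net_label N),
    y = existT (fun N => mark (net_order N)) (Network M) ((x1, y2), (x2, y1)).
Proof.
move=> M; exists (existT (fun N => mark (net_order N)) (Network M) ((x1, y2), (x2, y1))).
by split; [exists id => //; apply: giso_id|exists M].
Qed.

End SwapRelation.

Section BranchLeaves.
Variables (n J : nat).

(** The condition on [n - kret N] is carried along because the exchange preserves it; the last
    clause prevents a directed cycle. *)
Definition swappable_leaf (x : mnet n) : Prop :=
  let N := tag x in let E := net_arcs N in let e := tagged x in
  J <= n - kret N /\
  [/\ arcrel E e.1.1 e.1.2, is_branch E e.1.1, arcrel E e.2.1 e.2.2,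
      base_leaf E (net_label N) e.2.2 & ~~ connect (arcrel E) e.1.2 e.2.2].

Definition branch_leaf_mark (x : mnet n) : Prop :=
  let N := tag x in let E := net_arcs N in let e := tagged x in
  J <= n - kret N /\
  [/\ arcrel E e.1.1 e.1.2, is_leaf (net_label N) e.1.2, is_branch E e.1.1,
      arcrel E e.2.1 e.2.2 & ~~ is_ret E e.2.2].

Lemma branch_leaf_mark_iso x y : miso x y -> branch_leaf_mark x -> branch_leaf_mark y.
Proof.
case: x y => [N [[x1 y1] [x2 y2]]] [N' [[x1' y1'] [x2' y2']]] [f /= [fb fE fl]].
rewrite /map_mark /= => -[<- <- <- <-]; rewrite /branch_leaf_mark /= !fE (iso_leaf fb _ fl).
by rewrite (iso_branch fb fE) (iso_ret fb fE) /kret (iso_sum_ret fb fE).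
Qed.

Lemma swappable_leaf_swap x : swappable_leaf x -> exists2 y, branch_leaf_mark y & swap_rel x y.
Proof.
case: x => [N [[b v] [x a]]]; rewrite /swappable_leaf /=.
set E := net_arcs N; have H := network_axiom N; rewrite -/E in H.
case=> hJ [bv bb xa /andP[la ra] nc].
have [tb /forallP br] := andP bb.
have rv : ~~ is_ret E v by have := br v; rewrite bv.
have ra' : ~~ is_ret E a by rewrite (leaf_ret H la).
have rx : ~~ is_ret E x by rewrite (nret_pa H ra' xa).
have rb : ~~ is_ret E b by rewrite (tree_ret tb).
have nbx c d : arcrel E d c -> ~~ is_ret E c -> forall e, (e == d) || ~~ arcrel E e c.
  move=> dc rc e; case ec: (arcrel E e c); last by rewrite orbT.
  by rewrite (nret_uniq H rc ec dc) eqxx.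
have ry : is_ret E v = is_ret E a by rewrite (negbTE rv) (negbTE ra').
have na1 := nbx _ _ xa ra' b.
have na2 : (b == x) || ~~ arcrel E x v by rewrite eq_sym; apply: nbx bv rv x.
have nc1 : ~~ connect (arcrel E) v x.
  by apply: contra nc => /connect_trans; apply; apply: connect1.
have nc2 : ~~ connect (arcrel E) a b.
  by apply/negP => /(leaf_connect H la) e; move: tb; rewrite e (leaf_tree H la).
have H' := swap_simplex_tree_child H bv xa na1 na2 rb rx ry nc1 nc2.
have [y [xy [M ey]]] := swap_rel_ex H'.
exists y => //; rewrite {}ey.
have dg := swap_deg bv xa na1 na2.
rewrite /branch_leaf_mark /= -/E; split; [|split].
- by rewrite /kret /is_ret; under eq_bigr => u _ do rewrite dg.
- by rewrite swapE eqxx tpermR.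
- by [].
- rewrite /is_branch /is_tree dg -/(is_tree E b) tb /=; apply/forallP => c.
  rewrite /is_ret dg -/(is_ret E c) swapE eqxx /=; apply/implyP.
  by case: tpermP => [->|->|_ _ bc] //; have := br c; rewrite bc.
- by rewrite swapE eqxx orbT tpermL.
- by rewrite /is_ret dg.
Qed.

(** Every branch vertex can be paired with every base leaf: by [branch_disjoint] one of its two
    children is not above the leaf. *)
Lemma cnt_swappable_leaf (N : network n) : J <= n - kret N ->
  (n - kret N).-1 * (n - kret N) <= cnt swappable_leaf N.
Proof.
move=> hJ; set E := net_arcs N; have H := network_axiom N; rewrite -/E in H.
have -> : (n - kret N).-1 = #|[set b | is_branch E b]|.
  by rewrite card_set_sum; have := sum_branch H; rewrite /kret -/E; lia.
have -> : n - kret N = #|[set a | base_leaf E (net_label N) a]|.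
  by rewrite card_set_sum; have := sum_base_leaf H; rewrite /kret -/E; lia.
rewrite -cardsX.
pose c b a := odflt b [pick c | arcrel E b c && ~~ connect (arcrel E) c a].
apply: (card_le_inj (f := fun z => ((z.1, c z.1 z.2), (pa E z.2, z.2)))); last first.
  by move=> [b a] [b' a'] _ _ /= [-> _ _ ->].
move=> [b a]; rewrite !inE /= => /andP[bb ba]; split=> //=.
have [la _] := andP ba; have [da _] := leaf_deg H la.
have [tb /forallP br] := andP bb; have [_ d2] := tree_deg tb.
have [c1 bc1] : exists c1, arcrel E b c1.
  have /card_gt0P[c1] : 0 < #|[pred u | arcrel E b u]| by rewrite -/(outdeg E b) d2.
  by rewrite inE; exists c1.
have [c2 bc2 c21] := outdeg2_other d2 bc1.
have r1 : ~~ is_ret E c1 by have := br c1; rewrite bc1.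
have r2 : ~~ is_ret E c2 by have := br c2; rewrite bc2.
have := branch_disjoint H bc2 bc1 c21 r2 r1 ba; rewrite negb_and => nn.
have [bc nbc] : arcrel E b (c b a) /\ ~~ connect (arcrel E) (c b a) a.
  rewrite /c; case: pickP => [c0 /andP[]//|h].
  by case/orP: nn => nn; [have := h c2|have := h c1]; rewrite nn ?bc1 ?bc2.
by split=> //; apply: pa_arc; rewrite da.
Qed.

Lemma cnt_branch_leaf_mark (N : network n) :
  cnt branch_leaf_mark N <= (J <= n - kret N) * (#|leaf_of_branch N| * (4 * n)).
Proof.
set E := net_arcs N; have H := network_axiom N; rewrite -/E in H.
have [hJ|hJ] := boolP (J <= n - kret N); last first.
  rewrite mul0n /cnt leqn0 cards_eq0; apply/eqP/setP => e; rewrite !inE.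
  by apply/asboolP => -[/= h]; rewrite h in hJ.
rewrite mul1n; apply: (@leq_trans (#|leaf_of_branch N| * #|[set: 'I_(net_order N)]|)).
  (* The tail [x] is the only parent of the non-reticulation [v], so it need not be recorded. *)
  rewrite -cardsX; apply: (card_le_inj (f := fun e => (e.1, e.2.2))).
    move=> [[b a] [x v]]; rewrite !inE => -[_ [/= ba la bb _ _]].
    by rewrite ba la bb.
  move=> [[b a] [x v]] [[b' a'] [x' v']]; rewrite !inE.
  move=> -[_ [/= _ _ _ xv rv]] -[_ [/= _ _ _ xv' _]] [<- <- ev].
  by subst v'; rewrite (nret_uniq H rv xv xv').
by rewrite leq_mul2l cardsT card_ord net_order_bound orbT.
Qed.

Definition leaf_tree_mark (x : mnet n) : Prop :=
  let N := tag x in let E := net_arcs N in let e := tagged x in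
  [/\ arcrel E e.1.1 e.1.2, is_leaf (net_label N) e.1.2, is_branch E e.1.1,
      arcrel E e.2.1 e.2.2 & is_tree E e.2.2].

(** A single arc into a reticulation, repeated to fit the type [mark]. *)
Definition ret_arc_mark (x : mnet n) : Prop :=
  let N := tag x in let E := net_arcs N in let e := tagged x in
  [/\ arcrel E e.1.1 e.1.2, is_ret E e.1.2 & e.2 = e.1].

(** The conditions on [x] belong to the relation because restoring the subdivided arcs requires that
    they were arcs of [x]. *)
Definition add_ret_rel (x y : mnet n) : Prop :=
  let E := net_arcs (tag x) in let e := tagged x in
  [/\ leaf_tree_mark x &
  exists2 f : 'I_(net_order (tag x)) + bool -> 'I_(net_order (tag y)),
    giso (add_ret E e.1.1 e.1.2 e.2.1 e.2.2) (net_arcs (tag y))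
         (add_ret_label (net_label (tag x))) (net_label (tag y)) f
    & tagged y = map_mark f ((inr true, inr false), (inr true, inr false))].

Lemma ret_arc_mark_iso x y : miso x y -> ret_arc_mark x -> ret_arc_mark y.
Proof.
case: x y => [N [[x1 y1] [x2 y2]]] [N' [[x1' y1'] [x2' y2']]] [f /= [fb fE fl]].
rewrite /map_mark /= => -[<- <- <- <-]; rewrite /ret_arc_mark /= !fE (iso_ret fb fE).
by case=> ? ? [-> ->].
Qed.

Lemma leaf_tree_mark_add_ret x : leaf_tree_mark x -> exists2 y, ret_arc_mark y & add_ret_rel x y.
Proof.
case: x => [N [[b a] [x v]]] hx; have [/= ba la bb xv tv] := hx.
have H := network_axiom N.
have [M [f hf]] := network_of_graph (add_ret_simplex_tree_child H ba la bb xv tv).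
exists (existT _ M (map_mark f ((inr true, inr false), (inr true, inr false)))); last first.
  by split=> //; exists f.
have [fb fE fl] := hf; rewrite /ret_arc_mark /= fE (iso_ret fb fE) add_retE.
by rewrite add_ret_ret_rho.
Qed.

Lemma add_ret_rel_reflect x x' y y' :
  add_ret_rel x y -> add_ret_rel x' y' -> miso y y' -> miso x x'.
Proof.
case: x x' => [N [[b a] [x v]]] [N' [[b' a'] [x' v']]].
case=> -[/= ba la bb xv tv] [f hf ef] [[/= ba' la' bb' xv' tv']].
move=> [f' /giso_inv[g' [f'K g'K hg']] ef'] [h hh].
rewrite ef ef' /map_mark /= => -[e1 e2 _ _].
pose k := g' \o (h \o f).
have hk := giso_comp (giso_comp hf hh) hg'; rewrite -/k in hk.
have kw : k (inr true) = inr true by rewrite /k /= e1 f'K.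
have kr : k (inr false) = inr false by rewrite /k /= e2 f'K.
have [k' [kK k'K _]] := giso_inv hk.
have k'w : k' (inr true) = inr true by rewrite -kw kK.
have k'r : k' (inr false) = inr false by rewrite -kr kK.
(* Since [k] fixes both new vertices it maps old vertices to old ones; the default roots are never
   reached. *)
pose g u := if k (inl u) is inl u' then u' else net_root N'.
pose gi u := if k' (inl u) is inl u' then u' else net_root N.
have gE u : k (inl u) = inl (g u).
  rewrite /g; case e: (k (inl u)) => [//|[]].
    by have := kK (inl u); rewrite e k'w.
  by have := kK (inl u); rewrite e k'r.
have giE u : k' (inl u) = inl (gi u).
  rewrite /gi; case e: (k' (inl u)) => [//|[]].
    by have := k'K (inl u); rewrite e kw.
  by have := k'K (inl u); rewrite e kr.
have [_ kE kl] := hk; rewrite /= in kE kl.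
exists g => /=.
  split.
  - exists gi => u.
      by have := kK (inl u); rewrite gE giE => -[].
    by have := k'K (inl u); rewrite giE gE => -[].
  - move=> s t; rewrite (add_ret_restore ba xv) (add_ret_restore ba' xv').
    by rewrite -!gE -kw -kr -!add_retE !kE.
  - move=> i; have := kl i; rewrite !ffunE gE.
    by case.
have A u := kE (inl u) (inr true); have B u := kE (inl u) (inr false).
have C u := kE (inr true) (inl u); have D u := kE (inr false) (inl u).
have {}A : g x = x' by have := A x; rewrite gE kw !add_retE /= eqxx => /eqP.
have {}B : g b = b' by have := B b; rewrite gE kr !add_retE /= eqxx => /eqP.
have {}C : g v = v' by have := C v; rewrite gE kw !add_retE /= eqxx => /eqP.
have {}D : g a = a' by have := D a; rewrite gE kr !add_retE /= eqxx => /eqP.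
by rewrite /map_mark /= A B C D.
Qed.

Lemma cnt_leaf_tree_mark (N : network n) :
  #|leaf_of_branch N| * n.-1 <= cnt leaf_tree_mark N.
Proof.
set E := net_arcs N; have H := network_axiom N; rewrite -/E in H.
apply: (@leq_trans (#|leaf_of_branch N| * #|[set v | is_tree E v]|)).
  by rewrite leq_mul2l card_set_sum; have := sum_tree H; lia.
rewrite -cardsX; apply: (card_le_inj (f := fun z => (z.1, (pa E z.2, z.2)))).
  move=> [[b a] v]; rewrite !inE /= => /andP[/and3P[ba la bb] tv].
  by split=> //=; apply: pa_arc; case: (tree_deg tv) => ->.
by move=> [e v] [e' v'] _ _ /= [-> _ ->].
Qed.

Lemma cnt_ret_arc_mark (N : network n) : cnt ret_arc_mark N <= 2 * n.
Proof.
set E := net_arcs N; have H := network_axiom N; rewrite -/E in H.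
apply: (@leq_trans #|[set e : 'I_(net_order N) * 'I_(net_order N) | arcrel E e.1 e.2 && is_ret E e.2]|).
  apply: (card_le_inj (f := fun e => e.1)).
    by move=> [[w r] e]; rewrite !inE => -[/= -> -> _].
  by move=> [e1 e2] [e1' e2']; rewrite !inE => -[/= _ _ ->] [/= _ _ ->] ->.
have := sum_ret_le H; have := sum_ret_arc E; rewrite card_set_sum.
by rewrite pair_big /= => ->; lia.
Qed.

(* Networks with many leaves not below a reticulation are rare: moving such a
   leaf next to a branch vertex and then turning it into a leaf below a new
   reticulation has few preimages. *)
Lemma few_reticulations_rare :
  #|[set N in reps n | J <= n - kret N]| * (J.-1 * J) * n.-1 <= 8 * n * n * #|reps n|.
Proof.
(* Exchanges bound [S] from below and insertions from above; the factors [4 * n] and [2 * n] give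
   [8 * n * n]. *)
pose S := \sum_(N in reps n | J <= n - kret N) #|leaf_of_branch N|.
have s1 : #|[set N in reps n | J <= n - kret N]| * (J.-1 * J) <= S * (4 * n).
  apply: (@leq_trans (\sum_(N in reps n) cnt swappable_leaf N)).
    rewrite -sum1_card big_distrl /=.
    rewrite (eq_bigl (fun N => (N \in reps n) && (J <= n - kret N))); last first.
      by move=> N; rewrite !inE.
    rewrite big_mkcondr /=; apply: leq_sum => N _; case: ifP => // hJ.
    rewrite mul1n; apply: leq_trans (cnt_swappable_leaf hJ).
    by rewrite leq_mul // -!subn1 leq_sub2r.
  apply: leq_trans (rep_count swappable_leaf_swap branch_leaf_mark_iso (@swap_rel_reflect n)) _.
  rewrite /S big_mkcondr /= big_distrl /=; apply: leq_sum => N _.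
  by apply: leq_trans (cnt_branch_leaf_mark N) _; case: (J <= _); rewrite ?mul1n.
have s2 : S * n.-1 <= #|reps n| * (2 * n).
  apply: (@leq_trans (\sum_(N in reps n) cnt leaf_tree_mark N)).
    rewrite /S big_mkcondr /= big_distrl /=; apply: leq_sum => N _.
    by apply: leq_trans (cnt_leaf_tree_mark N); case: ifP.
  apply: leq_trans (rep_count leaf_tree_mark_add_ret ret_arc_mark_iso add_ret_rel_reflect) _.
  by rewrite -sum_nat_const; apply: leq_sum => N _; apply: cnt_ret_arc_mark.
apply: (@leq_trans (S * (4 * n) * n.-1)); first by rewrite leq_mul2r s1 orbT.
by rewrite mulnAC; apply: leq_trans (leq_mul s2 (leqnn _)) _; lia.
Qed.

End BranchLeaves.

(** * Short cycles *)

Section Balls.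
Variables (V : finType) (E : {set V * V}).

Definition nbr : rel V := fun u v => arcrel E u v || arcrel E v u.

Lemma nbr_sym : symmetric nbr.
Proof. by move=> u v; rewrite /nbr orbC. Qed.

Fixpoint ball (k : nat) (p : V) : {set V} :=
  if k is k'.+1 then ball k' p :|: [set v | [exists w in ball k' p, nbr w v]]
  else [set p].

Lemma ball_nbr k p w v : w \in ball k p -> nbr w v -> v \in ball k.+1 p.
Proof. by move=> wb wv; rewrite !inE; apply/orP; right; apply/exists_inP; exists w. Qed.

Lemma ball_mono k l p : k <= l -> ball k p \subset ball l p.
Proof.
elim: l => [|l IH]; first by rewrite leqn0 => /eqP ->.
rewrite leq_eqVlt => /orP[/eqP -> //|]; rewrite ltnS => /IH /fintype.subset_trans.
by apply; rewrite /= finset.subsetUl.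
Qed.

Lemma path_ball q s k : path nbr q s -> size s <= k -> q \in ball k (last q s).
Proof.
elim: s q k => [|w s IH] q k /=.
  by move=> _ _; apply: (fintype.subsetP (ball_mono _ (leq0n k))); rewrite inE.
case: k => [//|k] /andP[qw ws]; rewrite ltnS => sk.
by apply: ball_nbr (IH _ _ ws sk) _; rewrite nbr_sym.
Qed.

Lemma ball_path k p v : v \in ball k p ->
  exists s, [/\ path nbr v s, last v s = p & size s <= k].
Proof.
elim: k v => [|k IH] v; first by rewrite inE => /eqP ->; exists [::].
rewrite /= !inE => /orP[/IH[s [? ? ?]]|/exists_inP[w /IH[s [ws ls ks]] wv]].
  by exists s; split=> //; apply: leqW.
by exists (w :: s); split=> //=; rewrite nbr_sym wv.
Qed.

Lemma ball_sym k p v : v \in ball k p -> p \in ball k v.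
Proof.
move/ball_path=> [s [vs ls sk]]; rewrite -ls.
have := rev_path nbr v s; rewrite (eq_path (e' := nbr)); last by move=> a b; apply: nbr_sym.
rewrite vs => ps; have := path_ball ps; rewrite size_rev size_belast.
suff -> : last (last v s) (rev (belast v s)) = v by apply.
by case: s {vs ls sk ps} => //= w s; rewrite rev_cons last_rcons.
Qed.

(** Each step adds at most 3 neighbours per vertex, so it multiplies the size by at most [1 + 3]. *)
Lemma card_ball k p : (forall w, indeg E w + outdeg E w <= 3) -> #|ball k p| <= 4 ^ k.
Proof.
move=> deg; elim: k => [|k IH]; first by rewrite cards1.
have sub : [set v | [exists w in ball k p, nbr w v]] \subset
    \bigcup_(w in ball k p) [set v | nbr w v].
  apply/fintype.subsetP => v; rewrite inE => /exists_inP[w wb wv].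
  by apply/bigcupP; exists w; rewrite ?inE.
have nb w : #|[set v | nbr w v]| <= 3.
  apply: leq_trans (deg w); rewrite card_set_sum indeg_sum outdeg_sum -big_split /=.
  by apply: leq_sum => v _; rewrite /nbr; do 2 case: (arcrel _ _ _).
rewrite /= (leq_trans (leq_card_setU _ _)) // expnS.
apply: (@leq_trans (4 * #|ball k p|)); last by rewrite leq_mul2l IH.
rewrite (mulSn 3) leq_add2l (leq_trans (subset_leq_card sub)) //.
rewrite mulnC -sum_nat_const.
have : #|\bigcup_(w in ball k p) [set v | nbr w v]| <= \sum_(w in ball k p) #|[set v | nbr w v]|.
  by elim/big_ind2: _ => // [|A a B b hA hB]; rewrite ?cards0 // (leq_trans (leq_card_setU _ _)) ?leq_add.
by move/leq_trans; apply; apply: leq_sum => w _; apply: nb.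
Qed.

(** Both neighbours of [r] on the cycle are required to be parents; by [cycle_on_short_cycle] every
    cycle has such a vertex. The walk may repeat vertices other than [r]. *)
Definition on_short_cycle (L : nat) (r : V) : Prop :=
  exists p q s, [/\ arcrel E p r, arcrel E q r & p != q] /\
    [/\ path nbr q s, last q s = p, size s <= L & r \notin q :: s].

End Balls.

(** * Breaking short cycles by switching reticulations *)

Section ShortCycles.
Variables (n L : nat).

(** The walk also avoids the second reticulation, so the exchange leaves it intact. *)
Definition switchable (x : mnet n) : Prop :=
  let E := net_arcs (tag x) in let e := tagged x in
  [/\ arcrel E e.1.1 e.1.2, arcrel E e.2.1 e.2.2, is_ret E e.1.2, is_ret E e.2.2
    & e.1.2 != e.2.2] /\
  exists p s, [/\ p != e.1.1, arcrel E p e.1.2, path (nbr E) e.1.1 s, last e.1.1 s = p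
    & size s <= L] /\ (e.1.2 \notin e.1.1 :: s /\ e.2.2 \notin e.1.1 :: s).

(** The walk no longer closes up at one reticulation: it joins the first tail to the parent of
    [e.2.2] other than [e.2.1]. *)
Definition switched (x : mnet n) : Prop :=
  let E := net_arcs (tag x) in let e := tagged x in
  [/\ arcrel E e.1.1 e.1.2, arcrel E e.2.1 e.2.2, is_ret E e.1.2 & is_ret E e.2.2] /\
  exists p s, [/\ p != e.2.1, arcrel E p e.2.2, path (nbr E) e.1.1 s, last e.1.1 s = p
    & size s <= L].

Lemma switched_iso x y : miso x y -> switched x -> switched y.
Proof.
case: x y => [N [[x1 y1] [x2 y2]]] [N' [[x1' y1'] [x2' y2']]] [f /= [fb fE fl]].
rewrite /map_mark /= => -[<- <- <- <-]; rewrite /switched /= !fE !(iso_ret fb fE).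
case=> h [p [s [px pr ps ls sL]]]; split => //; exists (f p), (map f s).
split; rewrite ?fE ?size_map ?last_map ?ls //; first by rewrite (inj_eq (bij_inj fb)).
rewrite path_map (eq_path (e' := nbr (net_arcs N))) //.
by move=> u v; rewrite /nbr /= !fE.
Qed.

Lemma switchable_switch x : switchable x -> exists2 y, switched y & swap_rel x y.
Proof.
case: x => [N [[q r] [q' r']]]; rewrite /switchable /=.
set E := net_arcs N; have H := network_axiom N; rewrite -/E in H.
case=> -[qr qr' rr rr' ne] [p [s [[pq pr ps ls sL] [nr nr']]]].
have tq := par_ret H qr rr; have tq' := par_ret H qr' rr'.
have nar u v w : arcrel E u v -> is_ret E v -> is_ret E w -> v != w -> ~~ arcrel E u w.
  by move=> uv rv rw; apply: contraNN => uw; rewrite (ret_child_uniq H uv uw rv rw).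
have na1 : (q == q') || ~~ arcrel E q r' by rewrite (nar _ _ _ qr) ?orbT.
have na2 : (q == q') || ~~ arcrel E q' r by rewrite (nar _ _ _ qr') ?orbT // eq_sym.
have nc u v : is_ret E u -> is_tree E v -> ~~ connect (arcrel E) u v.
  move=> ru tv; apply/negP => /(ret_connect H ru)[e|lv].
    by move: tv; rewrite e ret_tree.
  by move: tv; rewrite (leaf_tree H lv).
have rq : ~~ is_ret E q by rewrite tree_ret.
have rq' : ~~ is_ret E q' by rewrite tree_ret.
have ry : is_ret E r = is_ret E r' by rewrite rr rr'.
have H' := swap_simplex_tree_child H qr qr' na1 na2 rq rq' ry (nc _ _ rr tq') (nc _ _ rr' tq).
have [y [xy [M ey]]] := swap_rel_ex H'.
exists y => //; rewrite {}ey.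
have dg := swap_deg qr qr' na1 na2.
have qq' : q != q' by apply: contraNneq ne => e; rewrite -e in qr'; rewrite (ret_child_uniq H qr qr').
rewrite /switched /= -/E /is_ret !dg; split; last exists p, s.
  by split; rewrite // swapE eqxx ?orbT ?tpermL ?tpermR.
have keep u v : v != r -> v != r' -> arcrel (swap E q r q' r') u v = arcrel E u v.
  by move=> vr vr'; rewrite swapE; case: (_ || _) => //; rewrite tpermD // eq_sym.
have pq' : p != q'.
  by apply: contraNneq ne => e; rewrite e in pr; rewrite (ret_child_uniq H pr qr').
split=> //; first by rewrite swapE (negbTE pq) (negbTE pq').
apply: (sub_in_path (P := [pred v | (v != r) && (v != r')])) ps.
  move=> u v /andP[ur ur'] /andP[vr vr'].
  by rewrite /nbr !keep.
apply/allP => v vs /=; apply/andP; split.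
  by apply: contraNneq nr => <-.
by apply: contraNneq nr' => <-.
Qed.

Definition short_rets (N : network n) : {set 'I_(net_order N)} :=
  [set r | `[< on_short_cycle (net_arcs N) L r >]].

Lemma short_retsP (N : network n) r :
  r \in short_rets N <-> on_short_cycle (net_arcs N) L r.
Proof. by rewrite /short_rets inE; split => /asboolP. Qed.

Lemma short_ret (N : network n) r : r \in short_rets N -> is_ret (net_arcs N) r.
Proof.
move/short_retsP => [p [q [s [[pr qr pq] _]]]].
apply: contraNT pq => nr; apply/eqP.
exact: (nret_uniq (network_axiom N) nr pr qr).
Qed.

Lemma cnt_switchable (N : network n) :
  #|short_rets N| * (kret N - L.+2) <= cnt switchable N.
Proof.
set E := net_arcs N; have H := network_axiom N; rewrite -/E in H.
have ex r : exists z : 'I_(net_order N) * 'I_(net_order N) * seq 'I_(net_order N),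
    r \in short_rets N -> let: (p, q, s) := z in [/\ arcrel E p r, arcrel E q r & p != q] /\
    [/\ path (nbr E) q s, last q s = p, size s <= L & r \notin q :: s].
  have [rB|rB] := boolP (r \in short_rets N); last by exists (r, r, [::]).
  by case/short_retsP: (rB) => p [q [s h]]; exists (p, q, s) => _.
have {ex}[F HF] := choice ex.
(* The second reticulation has to avoid [r], [q] and the at most [L] further vertices of the walk,
   hence [L.+2]. *)
pose W r := [set v in r :: (F r).1.2 :: (F r).2].
pose A r := [set v | is_ret E v] :\: W r.
have hA r : r \in short_rets N -> kret N - L.+2 <= #|A r|.
  move=> rB; rewrite cardsD kretE leq_sub2l //.
  apply: leq_trans (subset_leq_card (finset.subsetIr _ _)) _.
  rewrite cardsE; apply: leq_trans (card_size _) _ => /=.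
  by have := HF r rB; case: (F r) => [[p q] s] [_ [_ _ sL _]] /=; rewrite !ltnS.
apply: (@leq_trans #|[set z : 'I_(net_order N) * 'I_(net_order N) |
   (z.1 \in short_rets N) && (z.2 \in A z.1)]|).
  rewrite -sum_nat_const; apply: leq_trans (leq_sum _ (fun r rB => hA r rB)) _.
  rewrite -sum1_card; under eq_bigr => r _ do rewrite -sum1_card.
  rewrite pair_big_dep /=; apply: eq_leq; apply: eq_bigl => z; by rewrite !inE.
apply: (card_le_inj (f := fun z => (((F z.1).1.2, z.1), (pa E z.2, z.2)))); last first.
  by move=> [r r'] [u u'] _ _ /= [_ -> _ ->].
move=> [r r']; rewrite inE /= => /andP[rB].
rewrite !finset.in_setD !inE !negb_or => /andP[/and3P[r'r r'q r's] rr'].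
have := HF r rB; case: (F r) r'q r's => [[p q] s] /= r'q r's [[pr qr pq] [ps ls sL rs]].
split=> /=.
  split=> //; rewrite ?(short_ret rB) 1?eq_sym //.
  by apply: pa_arc; case: (ret_deg rr') => ->.
by exists p, s; split=> //; split=> //; rewrite inE negb_or r'q.
Qed.

Lemma deg_le3 (N : network n) w : indeg (net_arcs N) w + outdeg (net_arcs N) w <= 3.
Proof.
have H := network_axiom N.
case: (kindP H w) => [->|/(leaf_deg H)[-> ->]|/tree_deg[-> ->]|/ret_deg[-> ->]] //.
by case: (root_deg H) => -> ->.
Qed.

Lemma cnt_switched (N : network n) : cnt switched N <= 4 * n * 4 ^ L.
Proof.
set E := net_arcs N; have H := network_axiom N; rewrite -/E in H.
(* [P q] is the other parent of the only reticulation child of [q]. The walk puts the first tail in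
   the ball around [P] of the second tail, and the two tails determine both reticulations. *)
pose P q := odflt q [pick p | (p != q) && [exists r, [&& is_ret E r, arcrel E q r & arcrel E p r]]].
have PE p q r : p != q -> is_ret E r -> arcrel E q r -> arcrel E p r -> P q = p.
  move=> pq rr qr pr; rewrite /P; case: pickP => [u|/(_ p)]; last first.
    by rewrite pq /= => /existsP[]; exists r; rewrite rr qr pr.
  case/andP=> uq /existsP[t /and3P[rt qt ut]] /=.
  have et := ret_child_uniq H qt qr rt rr; rewrite {}et in ut.
  have d2 : indeg E r <= 2 by case: (ret_deg rr) => ->.
  have [|e|//] := indeg2 d2 qr pr ut; first by rewrite eq_sym.
  by rewrite e eqxx in uq.
apply: (@leq_trans #|[set z : 'I_(net_order N) * 'I_(net_order N) |
   z.2 \in ball E L (P z.1)]|); last first.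
  rewrite -sum1_card (eq_bigl (fun z => true && (z.2 \in ball E L (P z.1)))); last first.
    by move=> z; rewrite inE.
  rewrite -(pair_big_dep xpredT (fun i j => j \in ball E L (P i)) (fun _ _ => 1)) /=.
  apply: (@leq_trans (\sum_(i : 'I_(net_order N)) 4 ^ L)).
    by apply: leq_sum => i _; rewrite sum1_card card_ball //; apply: deg_le3.
  by rewrite sum_nat_const card_ord leq_mul2r net_order_bound orbT.
apply: (card_le_inj (f := fun e => (e.2.1, e.1.1))).
  move=> [[q r'] [q' r]]; rewrite !inE => -[/= [qr' q'r rr' rr] [p [s [pq pr ps ls sL]]]].
  by rewrite (PE p q' r) // -ls; apply: path_ball.
move=> [[q r'] [q' r]] [[u v'] [u' v]]; rewrite !inE.
move=> [/= [qr' q'r rr' rr] _] [/= [uv' u'v rv' rv] _] [e1 e2]; subst u u'.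
by rewrite (ret_child_uniq H qr' uv' rr' rv') (ret_child_uniq H q'r u'v rr rv).
Qed.

(* Exchanging the children of a parent of a reticulation on a short cycle and
   of a parent of another reticulation destroys the cycle in a way with few
   preimages. *)
Lemma few_short_cycles :
  \sum_(N in reps n) #|short_rets N| * (kret N - L.+2) <= #|reps n| * (4 * n * 4 ^ L).
Proof.
apply: leq_trans (leq_sum _ (fun N _ => cnt_switchable N)) _.
apply: leq_trans (rep_count switchable_switch switched_iso (@swap_rel_reflect n)) _.
by rewrite -sum_nat_const; apply: leq_sum => N _; apply: cnt_switched.
Qed.

End ShortCycles.

(** * The limit as a local covering *)

Lemma on_short_cycle_mono (V : finType) (E : {set V * V}) k l r :
  k <= l -> on_short_cycle E k r -> on_short_cycle E l r.
Proof.
move=> kl [p [q [s [h [ps ls sk rs]]]]]; exists p, q, s; split=> //.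
by split=> //; apply: leq_trans sk kl.
Qed.

Section Cycles.
Variables (n : nat) (V : finType) (E : {set V * V}) (o : V).
Variable lab : {ffun 'I_n -> V}.
Hypothesis H : simplex_tree_child E o lab.

(* The vertex of maximal rank of a cycle has its two neighbours as parents. *)
Lemma cycle_on_short_cycle (c : seq V) : cycle (nbr E) c -> uniq c -> 2 < size c ->
  exists2 r, r \in c & on_short_cycle E (size c) r.
Proof.
move=> cc uc sc; have [x0 x0c] : exists x, x \in c.
  by case: c sc {cc uc} => // x c _; exists x; rewrite inE eqxx.
case: (arg_maxnP (rank E) (x0c : (fun v => v \in c) x0)) => r rc rmax.
exists r => //; case: (rot_to rc) => i c' ec.
have szc : size c = (size c').+1 by rewrite -(size_rot i) ec.
have memc v : v \in r :: c' -> v \in c by rewrite -ec mem_rot.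
have up v : v \in c -> nbr E r v -> arcrel E v r.
  move=> vc /orP[rv|//]; have := rank_arc H rv.
  by have /= h := rmax _ vc; rewrite ltnNge h.
move: cc uc; rewrite -(rot_cycle i) -(rot_uniq i) {}ec szc => cc uc.
case: c' szc memc cc uc => [|q s] szc memc; first by rewrite szc in sc.
rewrite /= rcons_path => /and3P[rq qs pr] /and3P[rs qs' _].
exists (last q s), q, s; split; last by split=> //=; lia.
split.
- by rewrite nbr_sym in pr; apply: up pr; apply: memc; rewrite inE mem_last orbT.
- by apply: up rq; apply: memc; rewrite !inE eqxx orbT.
- case/lastP: s szc qs' {memc qs pr rs} => [szc|s' z _]; first by rewrite szc in sc.
  by rewrite last_rcons mem_rcons inE negb_or eq_sym => /andP[].
Qed.

End Cycles.

Lemma not_uniq_map (T : Type) (T' : eqType) (f : T -> T') (t : seq T) : ~~ uniq (map f t) ->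
  exists t1 a t2 b t3, t = t1 ++ a :: t2 ++ b :: t3 /\ f a = f b.
Proof.
elim: t => //= a t IH; rewrite negb_and negbK => /orP[|/IH].
  move=> fa; suff [t2 [b [t3 [-> e]]]] : exists t2 b t3, t = t2 ++ b :: t3 /\ f a = f b.
    by exists [::], a, t2, b, t3.
  elim: t fa {IH} => //= c t IH; rewrite inE => /orP[/eqP e|/IH].
    by exists [::], c, t.
  by move=> [t2 [b [t3 [-> e]]]]; exists (c :: t2), b, t3.
move=> [t1 [a' [t2 [b [t3 [-> e]]]]]].
by exists (a :: t1), a', t2, b, t3.
Qed.

Section Limit.

Definition limit_adj x y := limit_arc x y \/ limit_arc y x.

(** Distance from [Ret0] to index 0 of the spine; a new spine is entered two steps away from the
    vertex that it decorates, through the reticulation. *)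
Fixpoint spine_depth (s : spine) : nat :=
  if s is SpineW s i then spine_depth s + `|sval i| + 2 else 1.

Definition depth (x : limit_vertex) : nat :=
  match x with
  | SpineVertex s i => spine_depth s + `|i|
  | Ret0 => 0
  | Leaf0 => 1
  | Ret s i => spine_depth s + `|sval i| + 1
  | RetLeaf s i => spine_depth s + `|sval i| + 2
  end.

Lemma limit_arc_depth x y : limit_arc x y -> depth y <= (depth x).+1 /\ depth x <= (depth y).+1.
Proof. by case=> [s i|||| s i| s i| s i] /=; lia. Qed.

Lemma limit_adj_depth x y : limit_adj x y -> depth y <= (depth x).+1.
Proof. by case=> /limit_arc_depth[]. Qed.

Lemma within_depth k (x : reticulation_limit) :
  Defs.within k (Ret0 : reticulation_limit) x -> depth x <= k.
Proof.
elim: k x => [|k IH] x /=; first by move=> <-.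
case=> [/IH|[w [/IH wk wx]]]; first by lia.
by have := @limit_adj_depth w x wx; lia.
Qed.

(** One name for the reticulation child of any spine vertex: at index 0 it is the reticulation
    through which the spine was entered. *)
Definition ret_child (s : spine) (i : int) : limit_vertex :=
  if insub i is Some j then Ret s j
  else match s with SpineW s' j => Ret s' j | _ => Ret0 end.

Lemma ret_child_nz s (i : nzint) : ret_child s (sval i) = Ret s i.
Proof. by rewrite /ret_child -[sval i]/(val i) valK. Qed.

Lemma ret_child0 s : ret_child s 0%R = match s with SpineW s' j => Ret s' j | _ => Ret0 end.
Proof. by rewrite /ret_child insubF. Qed.

Lemma ret_child_arc s i : limit_arc (SpineVertex s i) (ret_child s i).
Proof.
have [->|i0] := eqVneq i 0%R; first by rewrite ret_child0; case: s => [||s j]; constructor.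
by rewrite -[i]/(sval (exist _ i i0 : nzint)) ret_child_nz; constructor.
Qed.

Lemma ret_child_mark s i : limit_mark (ret_child s i) = Reticulation.
Proof. by rewrite /ret_child; case: insub => // ; case: s. Qed.

Lemma limit_arc_out x y : limit_arc x y ->
  match x with
  | SpineVertex s i => y = SpineVertex s (i + 1)%R \/ y = ret_child s i
  | Ret0 => y = Leaf0
  | Ret s i => y = RetLeaf s i
  | _ => False
  end.
Proof.
case=> [s i|||| s i| s i| s i] //; try by left.
- by right; rewrite ret_child0.
- by right; rewrite ret_child0.
- by right; rewrite ret_child_nz.
- by right; rewrite ret_child0.
Qed.

Lemma limit_arc_in x y : limit_arc x y ->
  match y with
  | SpineVertex s i => x = SpineVertex s (i - 1)%R
  | Ret0 => x = SpineVertex SpineP 0 \/ x = SpineVertex SpineQ 0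
  | Ret s i => x = SpineVertex s (sval i) \/ x = SpineVertex (SpineW s i) 0
  | Leaf0 => x = Ret0
  | RetLeaf s i => x = Ret s i
  end.
Proof.
case=> [s i|||| s i| s i| s i] //; try by [left|right].
by rewrite GRing.addrK.
Qed.

Lemma limit_arc_pred s i : limit_arc (SpineVertex s (i - 1)%R) (SpineVertex s i).
Proof. by rewrite -{2}(GRing.subrK 1%R i); constructor. Qed.

End Limit.

(** * The covering map from the limit to a network *)

Section Covering.
Variables (n : nat) (V : finType) (E : {set V * V}) (o : V).
Variable lab : {ffun 'I_n -> V}.
Hypothesis H : simplex_tree_child E o lab.

Notation arc := (arcrel E).
Notation ret := (is_ret E).
Notation tree := (is_tree E).
Notation leaf := (is_leaf lab).

Definition next_spine v := odflt v [pick w | arc v w && ~~ ret w].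
Definition ret_of v := odflt v [pick w | arc v w && ret w].
Definition leaf_of r := odflt r [pick w | arc r w].
Definition other_parent r p := odflt p [pick q | arc q r && (q != p)].

(* The map below is a covering of the network near [r0] as long as the tree
   vertices it meets have a reticulation child; it takes junk values beyond. *)
Definition spine_walk (v : V) (i : int) : V :=
  match i with Posz k => iter k next_spine v | Negz k => iter k.+1 (pa E) v end.

Variable r0 : V.

(** The image of index 0. Which parent of [r0] starts which initial spine is arbitrary; every later
    spine is entered through the other parent of a reticulation. *)
Fixpoint spine_base (s : spine) : V :=
  match s with
  | SpineP => pa E r0
  | SpineQ => other_parent r0 (pa E r0)
  | SpineW s i => let x := spine_walk (spine_base s) (sval i) in other_parent (ret_of x) x
  end.

Definition cover (x : limit_vertex) : V :=
  match x with
  | SpineVertex s i => spine_walk (spine_base s) i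
  | Ret0 => r0
  | Leaf0 => leaf_of r0
  | Ret s i => ret_of (spine_walk (spine_base s) (sval i))
  | RetLeaf s i => leaf_of (ret_of (spine_walk (spine_base s) (sval i)))
  end.

Definition has_mark (v : V) (m : vkind) : bool :=
  match m with
  | Root => v == o | TreeVertex => tree v | Reticulation => ret v | Leaf => leaf v end.

Lemma has_mark_inj v m m' : has_mark v m -> has_mark v m' -> m = m'.
Proof.
have rr := root_ret H; have rt := root_tree H; have rl := root_leaf H.
case: m m' => -[] //= h h'; exfalso; move: h h';
  do ?[move=> /eqP ->; rewrite ?rr ?rt ?rl //]; do ?[move=> h /eqP e; move: h; rewrite e ?rr ?rt ?rl //].
all: do 1?[by move=> /tree_ret ->]; do 1?[by move=> /(tree_leaf H) ->]; do 1?[by move=> /ret_tree ->];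
  do 1?[by move=> /(ret_leaf H) ->]; do 1?[by move=> /(leaf_ret H) ->]; by move=> /(leaf_tree H) ->.
Qed.

Lemma next_spineP v : tree v -> arc v (next_spine v) /\ ~~ ret (next_spine v).
Proof.
move=> tv; rewrite /next_spine; case: pickP => [w /andP[]//|h].
have [w vw kw] := stc_tree_child H (negbT (tree_leaf H tv)).
by have := h w; rewrite vw -(nret_kind H vw) kw.
Qed.

Lemma ret_ofP v : tree v -> ~~ is_branch E v -> arc v (ret_of v) /\ ret (ret_of v).
Proof.
move=> tv /(branchPn tv)[r vr rr]; rewrite /ret_of; case: pickP => [w /andP[]//|/(_ r)].
by rewrite vr rr.
Qed.

Lemma leaf_ofP r : ret r -> arc r (leaf_of r) /\ leaf (leaf_of r).
Proof.
move=> rr; suff rl : arc r (leaf_of r) by split=> //; exact: (stc_one_component H rr rl).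
rewrite /leaf_of; case: pickP => // h.
have [w rw _] := stc_tree_child H (negbT (ret_leaf H rr)).
by have := h w; rewrite rw.
Qed.

Lemma other_parentP r p : ret r -> arc p r -> arc (other_parent r p) r /\ other_parent r p != p.
Proof.
move=> rr pr; rewrite /other_parent; case: pickP => [q /andP[]//|h].
have [q qr qp] := indeg2_other (proj1 (ret_deg rr)) pr.
by have := h q; rewrite qr qp.
Qed.

Variables K L : nat.
Hypothesis r0r : ret r0.
Hypothesis good : forall v, v \in ball E K r0 -> ~~ special E o lab v.
Hypothesis noshort : forall v, v \in ball E K r0 -> ~ on_short_cycle E L v.

Lemma good_branch v k : k <= K -> v \in ball E k r0 -> ~~ is_branch E v.
Proof.
move=> kK vb; have := good (fintype.subsetP (ball_mono E r0 kK) v vb).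
by rewrite /special !negb_or => /and3P[].
Qed.

Lemma good_root v k : k <= K -> v \in ball E k r0 -> v != o.
Proof.
move=> kK vb; have := good (fintype.subsetP (ball_mono E r0 kK) v vb).
by rewrite /special !negb_or => /and3P[].
Qed.

Lemma good_leaf v k : k <= K -> v \in ball E k r0 -> ~~ base_leaf E lab v.
Proof.
move=> kK vb; have := good (fintype.subsetP (ball_mono E r0 kK) v vb).
by rewrite /special !negb_or => /and3P[].
Qed.

(** A non-reticulation child is a tree vertex or a leaf, and a leaf there would be a base leaf,
    hence special. *)
Lemma next_spine_good v k : k < K -> v \in ball E k r0 -> tree v ->
  next_spine v \in ball E k.+1 r0 /\ tree (next_spine v).
Proof.
move=> kK vb tv; have [vw rw] := next_spineP tv.
have wb : next_spine v \in ball E k.+1 r0 by apply: ball_nbr vb _; rewrite /nbr vw.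
split=> //; move: (rw); rewrite -(nret_kind H vw) => /orP[//|lw].
have := good_leaf kK wb.
by rewrite /base_leaf lw -(nret_pa H rw vw) (tree_ret tv).
Qed.

Lemma pa_good v k : k < K -> v \in ball E k r0 -> tree v ->
  pa E v \in ball E k.+1 r0 /\ tree (pa E v).
Proof.
move=> kK vb tv; have wv : arc (pa E v) v by apply: pa_arc; case: (tree_deg tv) => ->.
have wb : pa E v \in ball E k.+1 r0 by apply: ball_nbr vb _; rewrite /nbr wv orbT.
split=> //; case: (kindP H (pa E v)) => // h.
- by have := good_root kK wb; rewrite h eqxx.
- by rewrite (leaf_arc H _ h) in wv.
- by have := par_tree H wv tv; rewrite h.
Qed.

Lemma iter_good f v k j :
  (forall u l, l < K -> u \in ball E l r0 -> tree u -> f u \in ball E l.+1 r0 /\ tree (f u)) ->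
  k + j <= K -> v \in ball E k r0 -> tree v ->
  iter j f v \in ball E (k + j) r0 /\ tree (iter j f v).
Proof.
move=> fg; elim: j => [|j IH]; first by rewrite addn0.
by rewrite addnS => kj vb tv; have [] := IH (ltnW kj) vb tv; apply: fg.
Qed.

Lemma spine_walk_good v k (i : int) : k + `|i| <= K -> v \in ball E k r0 -> tree v ->
  spine_walk v i \in ball E (k + `|i|) r0 /\ tree (spine_walk v i).
Proof.
case: i => j kj vb tv; apply: iter_good => // u l lK ub tu; first exact: next_spine_good.
exact: pa_good.
Qed.

Lemma cover_spine s i : depth (SpineVertex s i) <= K ->
  cover (SpineVertex s i) \in ball E (depth (SpineVertex s i)) r0 /\
  tree (cover (SpineVertex s i)).
Proof.
have pr := pa_arc (_ : 0 < indeg E r0); have {}pr : arc (pa E r0) r0.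
  by apply: pr; case: (ret_deg r0r) => ->.
have rb0 : r0 \in ball E 0 r0 by rewrite inE.
elim: s i => [||s IH j] i dK; apply: (@spine_walk_good (spine_base _) (spine_depth _)) => //.
- by apply: ball_nbr rb0 _; rewrite /nbr pr orbT.
- exact: (par_ret H pr r0r).
- by apply: ball_nbr rb0 _; rewrite /nbr (proj1 (other_parentP r0r pr)) orbT.
- exact: (par_ret H (proj1 (other_parentP r0r pr)) r0r).
- have dj : depth (SpineVertex s (sval j)) <= K by move: dK => /=; lia.
  have [xb tx] := IH _ dj; have [xr rr] := ret_ofP tx (good_branch dj xb).
  have [qr _] := other_parentP rr xr.
  rewrite /spine_depth -/spine_depth addn2.
  apply: (@ball_nbr _ _ _ _ (ret_of (cover (SpineVertex s (sval j))))).
    by apply: ball_nbr xb _; rewrite /nbr xr.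
  by rewrite /nbr qr orbT.
- have dj : depth (SpineVertex s (sval j)) <= K by move: dK => /=; lia.
  have [xb tx] := IH _ dj; have [xr rr] := ret_ofP tx (good_branch dj xb).
  have [qr _] := other_parentP rr xr.
  exact: (par_ret H qr rr).
Qed.

Lemma cover_ret s i : depth (SpineVertex s (sval i)) <= K ->
  let x := cover (SpineVertex s (sval i)) in
  [/\ arc x (cover (Ret s i)), ret (cover (Ret s i)),
      arc (cover (SpineVertex (SpineW s i) 0)) (cover (Ret s i))
    & cover (SpineVertex (SpineW s i) 0) != x].
Proof.
move=> dj x; have [xb tx] := cover_spine dj; have [xr rr] := ret_ofP tx (good_branch dj xb).
by have [qr qx] := other_parentP rr xr.
Qed.

Lemma cover_ret0 :
  [/\ arc (cover (SpineVertex SpineP 0)) r0, arc (cover (SpineVertex SpineQ 0)) r0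
    & cover (SpineVertex SpineQ 0) != cover (SpineVertex SpineP 0)].
Proof.
have pr : arc (pa E r0) r0 by apply: pa_arc; case: (ret_deg r0r) => ->.
by have [qr qx] := other_parentP r0r pr.
Qed.

Lemma cover_ok x : depth x <= K ->
  cover x \in ball E (depth x) r0 /\ has_mark (cover x) (limit_mark x).
Proof.
case: x => [s i|||s i|s i].
- exact: cover_spine.
- by move=> _; rewrite inE eqxx.
- move=> _; have [rl ll] := leaf_ofP r0r; split=> //.
  by apply: (@ball_nbr _ _ 0 _ r0); rewrite ?inE // /nbr rl.
- rewrite /= => dK; have dj : depth (SpineVertex s (sval i)) <= K by move: dK => /=; lia.
  have [xb tx] := cover_spine dj; have [xr rr _ _] := cover_ret dj.
  by split=> //; rewrite addn1; apply: ball_nbr xb _; rewrite /nbr xr.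
- rewrite /= => dK; have dj : depth (SpineVertex s (sval i)) <= K by move: dK => /=; lia.
  have [xb tx] := cover_spine dj; have [xr rr _ _] := cover_ret dj.
  have [rl ll] := leaf_ofP rr; split=> //; rewrite addn2.
  apply: (@ball_nbr _ _ _ _ (cover (Ret s i))); last by rewrite /nbr rl.
  by apply: ball_nbr xb _; rewrite /nbr xr.
Qed.

Lemma cover_arc x y : limit_arc x y -> depth x <= K -> depth y <= K -> arc (cover x) (cover y).
Proof.
have [pr qr _] := cover_ret0.
case=> [s i|||| s i| s i| s i] dx dy.
- have [_ tx] := cover_spine dx; have [_ ty] := cover_spine dy.
  case: i dx dy tx ty => j dx dy tx ty.
    have e : (Posz j + 1)%R = Posz j.+1 by lia.
    by rewrite e /=; case: (next_spineP tx).
  case: j {dx dy} tx ty => [|j] tx ty.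
    have e : (Negz 0 + 1)%R = Posz 0 by lia.
    by rewrite e /= in ty *; apply: pa_arc; case: (tree_deg ty) => ->.
  have e : (Negz j.+1 + 1)%R = Negz j by lia.
  by rewrite e /= in ty *; apply: pa_arc; case: (tree_deg ty) => ->.
- exact: pr.
- exact: qr.
- by case: (leaf_ofP r0r).
- by case: (cover_ret dx).
- have dj : depth (SpineVertex s (sval i)) <= K by move: dy => /=; lia.
  by case: (cover_ret dj).
- have dj : depth (SpineVertex s (sval i)) <= K by move: dx => /=; lia.
  by have [_ rr _ _] := cover_ret dj; case: (leaf_ofP rr).
Qed.

(** A vertex and its image have the same kind, hence the same outdegree, and the children of a spine
    vertex are told apart by their kinds. Children may be one step deeper, whence the strict
    bound. *)
Lemma cover_out x v : depth x < K -> arc (cover x) v ->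
  exists2 y, limit_arc x y & cover y = v.
Proof.
move=> dx xv; have [_ mx] := cover_ok (ltnW dx).
have nb y : limit_arc x y -> arc (cover x) (cover y) /\ has_mark (cover y) (limit_mark y).
  move=> xy; have [dy _] := limit_arc_depth xy; have {}dy := leq_trans dy dx.
  by split; [apply: cover_arc xy (ltnW dx) dy|case: (cover_ok dy)].
case: x dx xv mx nb => [s i|||s i|s i] dx xv mx nb.
- have [a1 m1] := nb _ (arc_spine s i); have [a2 m2] := nb _ (ret_child_arc s i).
  rewrite ret_child_mark in m2.
  have [rv|rv] := boolP (ret v).
    by exists (ret_child s i); [apply: ret_child_arc|apply: (ret_child_uniq H a2 xv m2 rv)].
  exists (SpineVertex s (i + 1)%R); first by constructor.
  by apply: (nret_child_uniq H a2 m2 a1 xv _ rv); rewrite tree_ret.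
- have [a1 m1] := nb _ arc_leaf0; exists Leaf0; first by constructor.
  by apply: outdeg1 a1 xv; case: (ret_deg mx) => _ ->.
- by rewrite (leaf_arc H _ mx) in xv.
- have [a1 m1] := nb _ (arc_leaf s i); exists (RetLeaf s i); first by constructor.
  by apply: outdeg1 a1 xv; case: (ret_deg mx) => _ ->.
- by rewrite (leaf_arc H _ mx) in xv.
Qed.

Lemma cover_in x v : depth x < K -> arc v (cover x) ->
  exists2 y, limit_arc y x & cover y = v.
Proof.
move=> dx vx; have [_ mx] := cover_ok (ltnW dx).
have nb y : limit_arc y x -> arc (cover y) (cover x).
  move=> yx; have [_ dy] := limit_arc_depth yx; have {}dy := leq_trans dy dx.
  exact: cover_arc yx dy (ltnW dx).
case: x dx vx mx nb => [s i|||s i|s i] dx vx mx nb.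
- exists (SpineVertex s (i - 1)%R); first exact: limit_arc_pred.
  apply: (nret_uniq H _ (nb _ (limit_arc_pred s i)) vx).
  by rewrite tree_ret.
- have [pr qr qp] := cover_ret0; have d2 : indeg E r0 <= 2 by case: (ret_deg r0r) => ->.
  have [->|->] := indeg2 d2 qr pr vx qp.
    by exists (SpineVertex SpineQ 0) => //; constructor.
  by exists (SpineVertex SpineP 0) => //; constructor.
- exists Ret0; first by constructor.
  by apply: (nret_uniq H _ (nb _ arc_leaf0) vx); rewrite (leaf_ret H).
- have dj : depth (SpineVertex s (sval i)) <= K by move: dx => /=; lia.
  have [pr rr qr qp] := cover_ret dj.
  have d2 : indeg E (cover (Ret s i)) <= 2 by case: (ret_deg rr) => ->.
  have [->|->] := indeg2 d2 qr pr vx qp.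
    by exists (SpineVertex (SpineW s i) 0) => //; constructor.
  by exists (SpineVertex s (sval i)) => //; constructor.
- exists (Ret s i); first by constructor.
  by apply: (nret_uniq H _ (nb _ (arc_leaf s i)) vx); rewrite (leaf_ret H).
Qed.

(** Two children differ in kind, two parents differ by the choice of [other_parent], and a child is
    not a parent by acyclicity. *)
Lemma cover_inj_adj x y y' : depth x < K -> limit_adj x y -> limit_adj x y' ->
  cover y = cover y' -> y = y'.
Proof.
move=> dx; have out z : limit_arc x z -> arc (cover x) (cover z) /\ has_mark (cover z) (limit_mark z).
  move=> xz; have [dz _] := limit_arc_depth xz; have {}dz := leq_trans dz dx.
  by split; [apply: cover_arc xz (ltnW dx) dz|case: (cover_ok dz)].
have inn z : limit_arc z x -> arc (cover z) (cover x).
  move=> zx; have [_ dz] := limit_arc_depth zx; have {}dz := leq_trans dz dx.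
  exact: cover_arc zx dz (ltnW dx).
have irr z z' : limit_arc x z -> limit_arc z' x -> cover z = cover z' -> False.
  move=> /out[xz _] /inn zx e; rewrite -e in zx.
  by have := arc_connectN H xz; rewrite connect1.
case=> [xy|yx] [xy'|y'x] e; try by case: (irr _ _ _ _ e).
- have [_ m] := out _ xy; have [_] := out _ xy'; rewrite -e => /(has_mark_inj m).
  have := limit_arc_out xy; have := limit_arc_out xy'.
  case: (x) => [s i|||s i|s i] //; try by move=> -> ->.
  by do 2 case=> ->; rewrite ?ret_child_mark.
- by case: (irr _ _ xy' yx (esym e)).
- have := limit_arc_in yx; have := limit_arc_in y'x.
  case: x dx {out inn irr yx y'x} => [s i|||s i|s i] dx; try by move=> -> ->.
    have [_ _ qp] := cover_ret0.
    by do 2 case=> ?; subst => //; move: qp; rewrite e eqxx.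
  have dj : depth (SpineVertex s (sval i)) <= K by move: dx => /=; lia.
  have [_ _ _ qp] := cover_ret dj.
  by do 2 case=> ?; subst => //; move: qp; rewrite e eqxx.
Qed.

Definition adjb : rel limit_vertex := fun x y => `[< limit_adj x y >].

Definition shallow k : pred limit_vertex := fun x => depth x <= k.

Lemma adjb_nbr k x y : k <= K -> shallow k x -> shallow k y -> adjb x y ->
  nbr E (cover x) (cover y).
Proof.
move=> kK hx hy; have {}hx := leq_trans hx kK; have {}hy := leq_trans hy kK.
rewrite /nbr => /asboolP[] h; first by rewrite (cover_arc h hx hy).
by rewrite (cover_arc h hy hx) orbT.
Qed.

(* A closed image of a walk in the tree, if not obtained from a closed walk,
   contains a cycle: otherwise it could be shortened. *)
Lemma cover_inj_walk k x s : k < K -> path adjb x s -> all (shallow k) (x :: s) ->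
  size s <= L -> cover x = cover (last x s) -> x = last x s.
Proof.
have ar a b c d : d = a + (b + c.+1) -> b < d /\ a + c < d by move=> ->; split; lia.
move=> kK; have [m] := ubnP (size s); elim: m x s => // m IH x s; rewrite ltnS => sm.
move=> ps /= /andP[hx hs] sL e.
case/lastP: s sm ps hs sL e => [//|s y]; rewrite size_rcons last_rcons => sm ps hs sL e.
have [uc|nu] := boolP (uniq (map cover (x :: s))); last first.
  have [t1 [a [t2 [b [t3 [et eab]]]]]] := not_uniq_map nu.
  have ew : t1 ++ a :: t2 ++ b :: rcons t3 y = rcons (x :: s) y.
    by rewrite et -!cats1 -!catA /= -!catA.
  have srt : sorted adjb (t1 ++ a :: t2 ++ b :: rcons t3 y) by rewrite ew.
  have al : all (shallow k) (t1 ++ a :: t2 ++ b :: rcons t3 y) by rewrite ew /= hx.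
  have [sz2 sz13] : size t2 < size s /\ size t1 + size t3 < size s.
    by apply: ar; have := congr1 size et; rewrite /= !size_cat /= size_cat /= addnS => -[].
  move: srt al; rewrite sorted_cat_cons cat_path all_cat /= all_cat /=.
  move=> /andP[s1 /and3P[p2 ab p3]] /and4P[a1 ha a2 /andP[hb a3]].
  (* A repeated image cuts out a shorter walk from [a] to [b] with closed image. By induction
     [a = b], and removing this loop leaves a shorter walk from [x] to [y]. *)
  have ab' : a = b.
    rewrite -[RHS](last_rcons a t2); apply: IH; rewrite ?size_rcons ?last_rcons //.
    - exact: leq_trans sm.
    - by rewrite rcons_path p2.
    - by rewrite /= ha all_rcons hb.
    - exact: leq_trans sz2 (ltnW sL).
  subst b; have srt : sorted adjb (t1 ++ a :: rcons t3 y) by rewrite sorted_cat_cons s1.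
  have al : all (shallow k) (t1 ++ a :: rcons t3 y) by rewrite all_cat a1 /= ha.
  have hd : exists t, t1 ++ a :: rcons t3 y = x :: rcons t y /\ size t = size t1 + size t3.
    case: t1 et {a1 s1 srt al sz13 ew} => [|x' t1] [<- _]; first by exists t3.
    by exists (t1 ++ a :: t3); rewrite rcons_cat size_cat /= addSn addnS.
  case: hd => t [et' st]; rewrite et' in srt al; rewrite -st in sz13.
  rewrite -[RHS](last_rcons x t); apply: IH; rewrite ?size_rcons ?last_rcons //.
    exact: leq_trans sm.
  exact: leq_trans sz13 (ltnW sL).
have [//|xy] := pselect (x = y); exfalso.
have al : all (shallow k) (x :: rcons s y) by rewrite /= hx.
have cyc : cycle (nbr E) (map cover (x :: s)).
  rewrite /= {2}e -map_rcons.
  have : path (fun u v => nbr E (cover u) (cover v)) x (rcons s y).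
    by apply: (sub_in_path _ al ps) => u v; apply: adjb_nbr (ltnW kK).
  by rewrite path_map.
(* With one vertex the image would be a loop arc; with two, [x] and [y] would be neighbours of the
   same vertex with equal images, which [cover_inj_adj] excludes. *)
have sc : 2 < size (map cover (x :: s)).
  rewrite size_map; case: s {cyc sm sL al} ps hs uc => [|a [|b s]] //=.
    rewrite andbT => xay /andP[hy _] _; have := adjb_nbr (ltnW kK) hx hy xay.
    by rewrite -e /nbr (arc_irr H).
  rewrite !andbT => /andP[/asboolP xa /asboolP ay] /andP[ha hy] _.
  case: xy; apply: (cover_inj_adj (leq_ltn_trans ha kK)) => //.
  by case: xa; [right|left].
have [r rc sh] := cycle_on_short_cycle H cyc uc sc.
apply: (@noshort r); last by apply: on_short_cycle_mono sh; rewrite size_map.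
have : all (fun v => v \in ball E K r0) (map cover (x :: s)).
  rewrite all_map; move: al; rewrite -cats1 -cat_cons all_cat => /andP[al _].
  apply: sub_all al => z hz /=; have zK := ltnW (leq_ltn_trans hz kK).
  by apply: (fintype.subsetP (ball_mono E r0 zK)); case: (cover_ok zK).
by move/allP; apply.
Qed.

Lemma within_walk k (x : reticulation_limit) : Defs.within k (Ret0 : reticulation_limit) x ->
  exists s, [/\ path adjb Ret0 s, last Ret0 s = x, size s <= k & all (shallow k) s].
Proof.
elim: k x => [|k IH] x /=; first by move=> <-; exists [::].
case=> [/IH[s [ps ls sk al]]|[w [/IH[s [ps ls sk al]] wx]]].
  exists s; split=> //; first exact: leqW.
  by apply: sub_all al => z; apply: leqW.
exists (rcons s x); rewrite rcons_path ps last_rcons size_rcons all_rcons ls.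
have aw : limit_adj w x by [].
split=> //; first exact/asboolP.
apply/andP; split; last by apply: sub_all al => z; apply: leqW.
apply: leq_trans (limit_adj_depth aw) _; rewrite ltnS.
suff : all (shallow k) (Ret0 :: s) by rewrite -ls; case/lastP: s {ps ls sk al} => [|s z] //=;
  rewrite last_rcons all_rcons => /andP[].
by rewrite /= al.
Qed.

(** Walks from [x] and from [y] to [Ret0] join into one of length at most [k + k], to which
    [cover_inj_walk] applies. *)
Lemma cover_inj k (x y : reticulation_limit) : k < K -> k + k <= L ->
  Defs.within k (Ret0 : reticulation_limit) x -> Defs.within k (Ret0 : reticulation_limit) y ->
  cover x = cover y -> x = y.
Proof.
move=> kK kL /within_walk[s [ps ls sk sa]] /within_walk[t [pt lt tk ta]] e.
have sym : (fun z => adjb^~ z) =2 adjb by move=> u v; apply/asboolP/asboolP => -[]; [right|left|right|left].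
have ps' : path adjb x (rev (belast Ret0 s)) by rewrite -ls rev_path (eq_path sym).
have lr : last x (rev (belast Ret0 s)) = Ret0.
  by case: s ls {ps sk sa ps'} => [<-|z s _] //=; rewrite rev_cons last_rcons.
have el : last x (rev (belast Ret0 s) ++ t) = y by rewrite last_cat lr.
rewrite -el; apply: (cover_inj_walk kK); last by rewrite el.
- by rewrite cat_path ps' lr.
- have : all (shallow k) (Ret0 :: s) by [].
  rewrite lastI all_rcons ls => /andP[hx hb].
  by rewrite /= hx all_cat all_rev hb ta.
- by rewrite size_cat size_rev size_belast; apply: leq_trans (leq_add sk tk) kL.
Qed.

End Covering.

Lemma within_ball n (x : pointed_network n) k u v :
  Defs.within k (u : pointed_graph x) v <-> v \in ball (net_arcs (projT1 x)) k u.
Proof.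
elim: k v => [|k IH] v /=; first by rewrite inE; split=> [->|/eqP->].
rewrite !inE; split.
  case=> [/IH ->//|[w [/IH wb wv]]]; apply/orP; right; apply/exists_inP; exists w => //.
  by apply/orP; case: wv; [left|right].
case/orP=> [/IH|/exists_inP[w wb wv]]; first by left.
by right; exists w; split; [apply/IH|apply/orP].
Qed.

(** The map only has to behave on the ball, since [cover] takes junk values far away; it runs from
    the limit, so the isomorphism is its inverse, obtained by choice. *)
Lemma rm_iso_ball k (G H : rmgraph) (f : H -> G) :
  f (rm_base H) = rm_base G ->
  (forall x, Defs.within k (rm_base H) x -> Defs.within k (rm_base G) (f x)) ->
  (forall x y, Defs.within k (rm_base H) x -> Defs.within k (rm_base H) y -> f x = f y -> x = y) ->
  (forall v, Defs.within k (rm_base G) v -> exists2 x, Defs.within k (rm_base H) x & f x = v) ->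
  (forall x, Defs.within k (rm_base H) x -> rm_mark G (f x) = rm_mark H x) ->
  (forall x y, Defs.within k (rm_base H) x -> Defs.within k (rm_base H) y ->
     rm_arc G (f x) (f y) <-> rm_arc H x y) ->
  rm_iso (local_ball k G) (local_ball k H).
Proof.
move=> fb fw fi fs fm fa.
pose g (x : local_ball k H) : local_ball k G := exist _ (f (sval x)) (fw _ (svalP x)).
have gs (v : local_ball k G) : exists x : local_ball k H, g x = v.
  case: v => v wv; have [x wx e] := fs v wv; exists (exist _ x wx).
  exact: (eq_exist _ _ e).
have [h gh] := choice gs.
have hg : cancel g h.
  move=> x; have := gh (g x) => /(congr1 sval) /= e.
  case: x (h (g x)) e => x wx [z wz] /= e.
  exact: (eq_exist _ _ (fi _ _ wz wx e)).
exists h; split.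
- by exists g.
- rewrite -[RHS]hg; congr h; exact: (eq_exist _ _ (esym fb)).
- by move=> v; rewrite -{2}(gh v) /= fm //; apply: svalP.
- by move=> u v; rewrite -{2}(gh u) -{2}(gh v) /= fa //; apply: svalP.
Qed.

(** * Neighbourhoods isomorphic to the limit *)

Definition looks_like_limit n (k : nat) (x : pointed_network n) : Prop :=
  rm_iso (local_ball k (pointed_graph x)) (local_ball k reticulation_limit).

Section LocalLimit.
Variables (n k : nat).
(** An arc between two images lifts to an arc that may end one step outside the ball of radius [k],
    so injectivity is needed at radius [k.+1]: this takes [k.+1 < K] and walks of length
    [k.+1 + k.+1]. *)
Notation K := k.+2.
Notation L := (k.+1 + k.+1).

Definition bad_vertex (N : network n) (v : 'I_(net_order N)) : bool :=
  special (net_arcs N) (net_root N) (net_label N) v || (v \in short_rets L N).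

Lemma looks_like_limit_ball (N : network n) r : r \in reticulations N ->
  (forall v, v \in ball (net_arcs N) K r -> ~~ bad_vertex v) ->
  looks_like_limit k (existT _ N r).
Proof.
rewrite inE => rr hb; have H := network_axiom N; set E := net_arcs N in H rr hb *.
have good v : v \in ball E K r -> ~~ special E (net_root N) (net_label N) v.
  by move=> /hb; rewrite negb_or => /andP[].
have nosh v : v \in ball E K r -> ~ on_short_cycle E L v.
  by move=> /hb; rewrite negb_or => /andP[_ /negP h] /short_retsP.
pose x0 : pointed_network n := existT _ N r.
have kK : k < K by lia.
have kK1 : k.+1 < K by [].
have hin j v : Defs.within j (r : pointed_graph x0) v <-> v \in ball E j r.
  exact: (@within_ball n x0).
apply: (@rm_iso_ball k (pointed_graph x0) reticulation_limit (cover E r)) => //.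
- move=> x /within_depth dx; apply/hin.
  have dK : depth x <= K := leq_trans dx (ltnW kK).
  by have [xb _] := cover_ok H rr good dK; apply: (fintype.subsetP (ball_mono E r dx)).
- move=> x y wx wy; apply: (cover_inj H rr good nosh kK) => //.
  by rewrite leq_add.
- have sur j v : j <= k -> v \in ball E j r ->
      exists2 x : reticulation_limit, Defs.within j (Ret0 : reticulation_limit) x & cover E r x = v.
    elim: j v => [|j IH] v jk; first by rewrite inE => /eqP ->; exists Ret0.
    rewrite /= !inE => /orP[/(IH _ (ltnW jk))[x wx e]|]; first by exists x => //; left.
    move=> /exists_inP[w /(IH _ (ltnW jk))[x wx <-] xv].
    have dx : depth x < K by apply: leq_ltn_trans (within_depth wx) _; lia.
    case/orP: xv => xv.
      have [y xy e] := cover_out H rr good dx xv.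
      by exists y => //; right; exists x; split=> //; left.
    have [y xy e] := cover_in H rr good dx xv.
    by exists y => //; right; exists x; split=> //; right.
  by move=> v /hin vb; apply: sur.
- move=> x /within_depth dx; have dK : depth x <= K := leq_trans dx (ltnW kK).
  have [_ m] := cover_ok H rr good dK; rewrite /= /net_mark /reticulations inE -/E.
  move: m; case: (limit_mark x) => /= m.
  + by rewrite m.
  + rewrite (tree_leaf H m) (tree_ret m); case: eqP => // e.
    by rewrite e (root_tree H) in m.
  + rewrite (ret_leaf H m) m; case: eqP => // e.
    by rewrite e (root_ret H) in m.
  + rewrite m; case: eqP => // e.
    by rewrite e (root_leaf H) in m.
- move=> x y wx wy; have dx := within_depth wx; have dy := within_depth wy.
  have dxK := leq_ltn_trans dx kK; have dyK := leq_ltn_trans dy kK.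
  split=> [xy|xy]; last exact: (cover_arc H rr good xy (ltnW dxK) (ltnW dyK)).
  have [y' xy' e] := cover_out H rr good dxK xy.
  suff -> : y = y' by [].
  apply: (cover_inj H rr good nosh kK1) => //; first by left.
  by right; exists x; split=> //; left.
Qed.

Definition bad_rets (N : network n) : {set 'I_(net_order N)} :=
  [set r in reticulations N | ~~ `[< looks_like_limit k (existT _ N r) >]].

(** Each bad reticulation lies in the ball of radius [K] around some bad vertex. *)
Lemma card_bad_rets (N : network n) :
  #|bad_rets N| <= 4 ^ K * (2 * (n - kret N) + #|short_rets L N|).
Proof.
have H := network_axiom N; set E := net_arcs N in H *.
have sub : bad_rets N \subset \bigcup_(v in [set v | bad_vertex v]) ball E K v.
  apply/fintype.subsetP => r; rewrite inE => /andP[rr nl]; apply/bigcupP.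
  have [h|h] := pselect (exists v, v \in ball E K r /\ bad_vertex v).
    by case: h => v [vb bv]; exists v; [by rewrite inE|exact: ball_sym].
  case/asboolP: nl; apply: looks_like_limit_ball => // v vb; apply/negP => bv.
  by case: h; exists v.
apply: leq_trans (subset_leq_card sub) _.
have : #|\bigcup_(v in [set v | bad_vertex v]) ball E K v| <=
    \sum_(v in [set v | bad_vertex v]) #|ball E K v|.
  by elim/big_ind2: _ => // [|A a B b hA hB]; rewrite ?cards0 // (leq_trans (leq_card_setU _ _)) ?leq_add.
move/leq_trans; apply; apply: (@leq_trans (\sum_(v in [set v | bad_vertex v]) 4 ^ K)).
  by apply: leq_sum => v _; apply: card_ball; apply: deg_le3.
rewrite sum_nat_const mulnC leq_mul2l; apply/orP; right.
apply: leq_trans (leq_add (sum_special H) (leqnn _)).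
rewrite -card_set_sum; apply: leq_trans (leq_card_setU _ _).
by apply/subset_leq_card/fintype.subsetP => v; rewrite !inE /bad_vertex inE.
Qed.

End LocalLimit.

(** * Invariance under isomorphism *)

Lemma rm_iso_sym G H : rm_iso G H -> rm_iso H G.
Proof.
case=> f [[g fK gK] fb fm fa]; exists g; split.
- by exists f.
- by rewrite -fb fK.
- by move=> v; rewrite -fm gK.
- by move=> u v; rewrite -fa !gK.
Qed.

Lemma rm_iso_trans G H I : rm_iso G H -> rm_iso H I -> rm_iso G I.
Proof.
case=> f [fj fb fm fa] [g [gj gb gm ga]]; exists (g \o f); split.
- exact: bij_comp.
- by rewrite /= fb.
- by move=> v; rewrite /= gm.
- by move=> u v; rewrite /= ga.
Qed.

Lemma rm_iso_local_ball k G H : rm_iso G H -> rm_iso (local_ball k G) (local_ball k H).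
Proof.
have pres (G' H' : rmgraph) (f : G' -> H') j u v : (forall u v, rm_arc H' (f u) (f v) <-> rm_arc G' u v) ->
    Defs.within j u v -> Defs.within j (f u) (f v).
  move=> fa; elim: j v => [|j IH] v /=; first by move=> ->.
  case=> [/IH|[w [/IH uw wv]]]; first by left.
  by right; exists (f w); split=> //; rewrite !fa.
case/rm_iso_sym => f [[g fK gK] fb fm fa].
have ga u v : rm_arc H (g u) (g v) <-> rm_arc G u v by rewrite -fa !gK.
apply: (@rm_iso_ball k G H f) => //.
- by move=> x; rewrite -fb; apply: pres.
- by move=> x y _ _ e; rewrite -(fK x) e fK.
- by move=> v wv; exists (g v); rewrite ?gK // -(fK (rm_base H)) fb; apply: pres.
Qed.

Lemma looks_like_limit_iso n k (N M : network n) f v :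
  giso (net_arcs N) (net_arcs M) (net_label N) (net_label M) f ->
  looks_like_limit k (existT _ N v) <-> looks_like_limit k (existT _ M (f v)).
Proof.
move=> hf; have [fb fE fl] := hf.
suff h : rm_iso (pointed_graph (existT (fun N : network n => 'I_(net_order N)) N v))
                (pointed_graph (existT (fun N : network n => 'I_(net_order N)) M (f v))).
  split; last exact/rm_iso_trans/rm_iso_local_ball.
  by apply: rm_iso_trans; apply/rm_iso_local_ball/rm_iso_sym.
exists f; split=> //= [u|u w]; last by rewrite fE.
rewrite /net_mark /reticulations !inE (iso_leaf fb _ fl) (iso_ret fb fE).
by rewrite -(iso_root (network_axiom N) (network_axiom M) hf) (inj_eq (bij_inj fb)).
Qed.

Lemma card_bad_rets_iso n k (N M : network n) : net_iso N M ->
  #|bad_rets k N| = #|bad_rets k M|.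
Proof.
case=> f hf; have [fb fE fl] := hf; rewrite /bad_rets !card_set_sum.
rewrite [RHS](reindex f) /=; last exact: onW_bij.
apply: eq_bigr => v _; rewrite !inE (iso_ret fb fE); congr (nat_of_bool (_ && ~~ _)).
by apply/asboolP/asboolP => /(looks_like_limit_iso k v hf).
Qed.

Lemma kret_iso n (N M : network n) : net_iso N M -> kret N = kret M.
Proof. by case=> f [fb fE fl]; rewrite /kret -(iso_sum_ret fb fE). Qed.

(** * Probabilities *)

Import Order.TTheory GRing.Theory Num.Theory.
Local Open Scope classical_set_scope.
Local Open Scope ring_scope.

Lemma measure_preimage_finType (R : realType) d (T : measurableType d) (P : probability T R)
    (I : finType) (X : T -> I) (A : pred I) :
  (forall x, measurable (X @^-1` [set x])) ->
  measurable [set t | A (X t)] /\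
  P [set t | A (X t)] = (\sum_(x | A x) fine (P (X @^-1` [set x])))%:E.
Proof.
move=> mX.
have e : [set t | A (X t)] = \bigcup_(x in [set x | A x]) (X @^-1` [set x]).
  apply/seteqP; split=> [t At|t [x Ax /= e]]; first by exists (X t).
  by rewrite /= e.
have fA : finite_set [set x | A x] by apply: finite_finset.
split; first by rewrite e; apply: fin_bigcup_measurable.
rewrite e measure_fin_bigcup //; last first.
  by move=> i j _ _ [t [/= Xi Xj]]; rewrite -Xi -Xj.
have -> : [set x | A x] = [set` enum A].
  by apply/seteqP; split=> x /=; rewrite mem_enum.
rewrite -fsbig_seq ?enum_uniq // big_enum /= EFin_sum_fine //.
by move=> x _; apply: fin_num_measure.
Qed.

Section Uniform.
Variables (R : realType) (d : measure_display) (T : measurableType d) (P : probability T R).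
Variables (n : nat) (X : T -> pointed_network n) (k : nat).
Hypothesis hX : uniform_network_reticulation P X.

(** Pointed networks as a finite type, with the masses [p] of pairs and [q] of networks. *)
Let I : finType := {N : network n & 'I_(net_order N)}.
Let Y : T -> I := X.
Let pt (N : network n) (v : 'I_(net_order N)) : I :=
  existT (fun N : network n => 'I_(net_order N)) N v.
Let p (x : I) : R := fine (P (Y @^-1` [set x])).
Let q (N : network n) : R := \sum_(v : 'I_(net_order N)) p (pt v).

Variable C : R.
Hypothesis hC : forall N : network n, P [set t | net_iso N (projT1 (X t))] = C%:E.

Lemma preimage_measurable x : measurable (Y @^-1` [set x]).
Proof. exact: unr_measurable hX x. Qed.

Lemma pointed_prob_pred (A : pred I) : P [set t | A (Y t)] = (\sum_(x | A x) p x)%:E.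
Proof. by have [_ ->] := measure_preimage_finType P A preimage_measurable. Qed.

Lemma pointed_prob_ge0 x : 0 <= p x.
Proof. by apply: fine_ge0. Qed.

Lemma pointed_prob_sum_network (A : pred I) :
  \sum_(x | A x) p x = \sum_(N : network n) \sum_(v : 'I_(net_order N) | A (pt v)) p (pt v).
Proof.
rewrite (sig_big_dep xpredT (fun (N : network n) (v : 'I_(net_order N)) => A (pt v))
  (fun (N : network n) (v : 'I_(net_order N)) => p (pt v))) /=.
by apply: eq_big => [[N v]|[N v] _].
Qed.

Lemma network_prob N : P [set t | projT1 (X t) = N] = (q N)%:E.
Proof.
have -> : [set t | projT1 (X t) = N] = [set t | (fun x : I => tag x == N) (Y t)].
  by apply/seteqP; split=> t /= /eqP.
rewrite (pointed_prob_pred (fun x : I => tag x == N)) pointed_prob_sum_network (bigD1 N) //=.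
rewrite [X in _ + X]big1 ?addr0; last first.
  by move=> M MN; rewrite big_pred0 // => v; rewrite (negbTE MN).
by congr (_%:E); apply: eq_bigl => v; rewrite eqxx.
Qed.

Lemma sum_network_prob : \sum_N q N = 1.
Proof.
have := pointed_prob_pred xpredT; rewrite pointed_prob_sum_network => h.
have := probability_setT P; rewrite (_ : setT = [set t | xpredT (Y t)]); last first.
  by apply/seteqP; split.
by rewrite h => -[].
Qed.

Lemma sum_class_prob N : \sum_(M | `[< net_iso N M >]) q M = C.
Proof.
have := hC N.
have -> : [set t | net_iso N (projT1 (X t))] = [set t | (fun x : I => `[< net_iso N (tag x) >]) (Y t)].
  by apply/seteqP; split=> t /= /asboolP.
rewrite (pointed_prob_pred (fun x : I => `[< net_iso N (tag x) >])) pointed_prob_sum_network => -[<-]; rewrite big_mkcond /=; apply: eq_bigr => M _.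
by case: ifP => h; [|rewrite big_pred0].
Qed.

(** The mass of a class may be spread in any way over isomorphic networks, so only means of class
    invariants are determined. *)
Lemma sum_network_prob_reps (f : network n -> R) : (forall N M, net_iso N M -> f N = f M) ->
  \sum_N q N * f N = \sum_(N in reps n) C * f N.
Proof.
move=> fi; rewrite (partition_big (@canon n) (fun N => N \in reps n)) /=; last first.
  by move=> N _; apply: canon_reps.
apply: eq_bigr => N rN; rewrite -(sum_class_prob N) mulr_suml.
apply: eq_big => M; last by move=> /eqP <-; congr (_ * _); apply: fi; apply: canon_iso.
apply/eqP/asboolP => [<-|/canon_eq <-]; first exact/net_iso_sym/canon_iso.
by apply/eqP; move: rN; rewrite inE.
Qed.

(** Total mass 1 determines [C], which avoids comparing [reps n] with [iso_classes n]. *)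
Lemma class_prob_card_reps : C * #|reps n|%:R = 1.
Proof.
rewrite mulr_natr -sumr_const -sum_network_prob; apply/esym.
have := @sum_network_prob_reps (fun=> 1) (fun _ _ _ => erefl).
under eq_bigr do rewrite mulr1.
by under [RHS]eq_bigr do rewrite mulr1.
Qed.

(** Without reticulations the distinguished vertex is arbitrary, so the worst value 1 is charged. *)
Definition bad_ratio (N : network n) : R :=
  if kret N == 0%N then 1 else #|bad_rets k N|%:R / (kret N)%:R.

Lemma ret_prob N (v : 'I_(net_order N)) : v \in reticulations N -> p (pt v) = q N / (kret N)%:R.
Proof.
move=> rv; have := unr_reticulation hX rv; rewrite network_prob -EFinM -kretE => h.
by rewrite /p; have -> : P (Y @^-1` [set pt v]) = (q N * (kret N)%:R^-1)%:E by exact: h.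
Qed.

Lemma sum_p_bad N :
  \sum_(v : 'I_(net_order N) | ~~ `[< looks_like_limit k (pt v) >]) p (pt v) <= q N * bad_ratio N.
Proof.
rewrite /bad_ratio; case: eqP => [_|/eqP k0].
  rewrite mulr1 /q [leRHS](bigID (fun v => ~~ `[< looks_like_limit k (pt v) >])) /=.
  by rewrite lerDl sumr_ge0 // => v _; apply: pointed_prob_ge0.
have k0' : (kret N)%:R != 0 :> R by rewrite pnatr_eq0.
have qs : \sum_(v in reticulations N) p (pt v) = q N.
  under eq_bigr => v rv do rewrite (ret_prob rv).
  by rewrite sumr_const -[LHS]mulr_natr -kretE (divfK k0').
(* The reticulations already carry all of the mass [q N]. *)
have nr : \sum_(v | v \notin reticulations N) p (pt v) = 0.
  have : q N = \sum_(v in reticulations N) p (pt v) + \sum_(v | v \notin reticulations N) p (pt v).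
    by rewrite /q (bigID (fun v => v \in reticulations N)).
  by rewrite qs -{1}[q N]addr0 => /addrI <-.
have nr0 v : v \notin reticulations N -> p (pt v) = 0.
  move=> nv; have /eqP := nr; rewrite psumr_eq0 => [/allP/(_ v)|u _]; last exact: pointed_prob_ge0.
  by rewrite mem_index_enum nv /= => /(_ isT)/eqP.
rewrite (bigID (fun v => v \in reticulations N)) /= [X in _ + X]big1 ?addr0; last first.
  by move=> v /andP[_]; apply: nr0.
rewrite (eq_bigl (fun v => v \in bad_rets k N)); last by move=> v; rewrite !inE andbC.
rewrite (eq_bigr (fun=> q N / (kret N)%:R)); last first.
  by move=> v; rewrite inE => /andP[rv _]; apply: ret_prob.
by rewrite sumr_const -[leLHS]mulr_natr -mulrA [X in _ * X <= _]mulrC.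
Qed.

Lemma prob_bad : (P [set t | ~ looks_like_limit k (X t)] <=
   ((\sum_(N in reps n) bad_ratio N) / #|reps n|%:R)%R%:E)%E.
Proof.
have -> : [set t | ~ looks_like_limit k (X t)] =
    [set t | (fun x : I => ~~ `[< looks_like_limit k x >]) (Y t)].
  by apply/seteqP; split=> t /= /asboolPn.
rewrite (pointed_prob_pred (fun x : I => ~~ `[< looks_like_limit k x >])) lee_fin pointed_prob_sum_network.
apply: le_trans (ler_sum _ (fun N _ => sum_p_bad N)) _.
rewrite (sum_network_prob_reps (f := bad_ratio)); last first.
  by move=> N M NM; rewrite /bad_ratio (kret_iso NM) (card_bad_rets_iso k NM).
have r0 : #|reps n|%:R != 0 :> R.
  by apply/eqP => e; have := class_prob_card_reps; rewrite e mulr0 => /eqP; rewrite eq_sym oner_eq0.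
by rewrite -mulr_sumr mulrC ler_wpM2l ?sumr_ge0 //; [move=> N _|];
  rewrite ?/bad_ratio; [case: ifP => // _; rewrite divr_ge0 ?ler0n|rewrite -[C](mulfK r0) class_prob_card_reps mul1r].
Qed.

Lemma measurable_looks_like_limit : measurable [set t | looks_like_limit k (X t)].
Proof.
have [+ _] := measure_preimage_finType P (fun x : I => `[< looks_like_limit k x >]) preimage_measurable.
rewrite (_ : [set t | looks_like_limit k (X t)] = [set t | `[< looks_like_limit k (Y t) >]]) //.
by apply/seteqP; split=> t /= /asboolP.
Qed.

End Uniform.

(** * Convergence *)

Section Bound.
Variables (R : realType) (n k M : nat).
Notation K := k.+2.
Notation L := (k.+1 + k.+1)%N.
Notation ratio := (@bad_ratio R n k).

Lemma bad_ratio_le J (N : network n) : (0 < n)%N -> (2 * J <= n)%N -> (4 * L.+2 <= n)%N ->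
  ratio N <= (J <= n - kret N)%N%:R + (4 ^ K)%N%:R * (4 * J)%N%:R / n%:R
    + (4 ^ K)%N%:R * 8 / n%:R ^+ 2 * (#|short_rets L N| * (kret N - L.+2))%N%:R.
Proof.
move=> n0 hJ hL; have n0' : 0 < n%:R :> R by rewrite ltr0n.
have [JN|JN] := leqP J (n - kret N).
  rewrite -addrA ler_wpDr // ?addr_ge0 ?mulr_ge0 ?divr_ge0 ?ler0n ?exprn_ge0 //.
  rewrite /bad_ratio; case: eqP => // /eqP k0.
  rewrite ler_pdivrMr ?ltr0n ?lt0n // mul1r ler_nat kretE.
  by apply/subset_leq_card/fintype.subsetP => v; rewrite inE => /andP[].
(* At least half as many reticulations as taxa; discarding [L.+2] of them still leaves a quarter of
   [n]. *)
rewrite add0r; have kn : (n <= 2 * kret N)%N by lia.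
have tn : (n <= 4 * (kret N - L.+2))%N by lia.
rewrite /bad_ratio gtn_eqF; last by lia.
have hb := card_bad_rets k N; have jn : (n - kret N <= J)%N := ltnW JN.
set s := #|short_rets _ N| in hb *; set b := #|_| in hb *.
move: (kret N) kn tn jn hb => r kn tn jn hb.
have hb' : (b <= 4 ^ K * (2 * J + s))%N.
  by apply: leq_trans hb _; rewrite leq_mul2l leq_add2r leq_mul2l jn !orbT.
have r0 : 0 < r%:R :> R by rewrite ltr0n; lia.
have h1 : b%:R / r%:R <= b%:R * 2 / n%:R :> R.
  rewrite ler_pdivrMr // mulrAC ler_pdivlMr // -mulrA ler_wpM2l ?ler0n //.
  by rewrite -natrM ler_nat.
apply: (le_trans h1).
have h2 : b%:R * 2 / n%:R <= (4 ^ K)%N%:R * (2 * J + s)%N%:R * 2 / n%:R :> R.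
  rewrite ler_pM2r ?invr_gt0 // ler_pM2r ?ltr0n // -natrM ler_nat.
  exact: hb'.
apply: (le_trans h2); rewrite (natrD _ (2 * J)%N s).
have dist (x y z t : R) : x * (y + z) * 2 * t = x * y * 2 * t + x * z * 2 * t by ring.
rewrite dist lerD //.
  by rewrite (_ : (4 * J)%N = (2 * J * 2)%N); [rewrite [(_ * 2)%:R]natrM !mulrA|lia].
rewrite -!mulrA ler_wpM2l ?ler0n // natrM.
(* The factor [4 (r - L.+2) / n], at least 1, brings in the summand of [few_short_cycles]. *)
rewrite [leRHS](_ : _ = s%:R * (8 * (r - L.+2)%N%:R / n%:R ^+ 2)); last by field; lra.
rewrite ler_wpM2l ?ler0n // ler_pdivlMr ?exprn_gt0 // expr2 mulrA divfK ?gt_eqF //.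
by rewrite -!natrM ler_nat; lia.
Qed.

Lemma many_leaves_rare : (1 < M)%N -> (1 < n)%N -> (4 * M <= n)%N ->
  (#|[set N in reps n | n %/ M <= n - kret N]%N| * n <= 64 * M ^ 2 * #|reps n|)%N.
Proof.
move=> M1 n1 Mn; have := few_reticulations_rare n (n %/ M).
set J := (n %/ M)%N; set a := #|_|; set c := #|reps n| => h.
have h1 : (n <= 2 * M * J.-1)%N.
  (* [4 * M <= n] absorbs the rounding in [J] and the predecessor. *)
  have := ltn_ceil n (ltnW M1); rewrite -/J => hJ; nia.
have h2 : (n <= 2 * M * J)%N by apply: leq_trans h1 _; rewrite leq_mul2l leq_pred orbT.
have h3 : (n <= 2 * n.-1)%N by lia.
have h4 := leq_mul (leq_mul h1 h2) h3.
have n0 : (0 < n * n)%N by rewrite muln_gt0 (ltnW n1).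
rewrite -(leq_pmul2r n0).
have /leq_trans : (a * n * (n * n) <= a * (2 * M * J.-1 * (2 * M * J) * (2 * n.-1)))%N.
  by rewrite -mulnA leq_mul2l mulnA h4 orbT.
apply; have e : (a * (2 * M * J.-1 * (2 * M * J) * (2 * n.-1)) =
   8 * M ^ 2 * (a * (J.-1 * J) * n.-1))%N by rewrite -mulnn; ring.
rewrite e; apply: leq_trans (leq_mul (leqnn _) h) _.
by rewrite -mulnn; apply: eq_leq; ring.
Qed.

Lemma mean_bad_ratio_le : (1 < M)%N -> (1 < n)%N -> (4 * M <= n)%N -> (4 * L.+2 <= n)%N ->
  (\sum_(N in reps n) ratio N) / #|reps n|%:R <=
  (4 * 4 ^ K)%N%:R / M%:R + (64 * M ^ 2 + 32 * 4 ^ K * 4 ^ L)%N%:R / n%:R.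
Proof.
move=> M1 n1 Mn Ln; have n0 : (0 < n)%N by exact: ltnW.
have n0' : 0 < n%:R :> R by rewrite ltr0n.
have M0 : 0 < M%:R :> R by rewrite ltr0n ltnW.
set J := (n %/ M)%N.
have hJ : (J * M <= n)%N by exact: leq_trunc_div.
have [c0|c0] := posnP #|reps n|.
  by rewrite c0 invr0 mulr0 addr_ge0 // divr_ge0 ?ler0n.
rewrite ler_pdivrMr ?ltr0n //.
have J2 : (2 * J <= n)%N by apply: leq_trans hJ; rewrite mulnC leq_mul2l M1 orbT.
apply: le_trans (ler_sum _ (fun N _ => bad_ratio_le N n0 J2 Ln)) _.
rewrite !big_split /= sumr_const -[X in _ + X <= _]mulr_sumr -!natr_sum.
set c := #|reps n| in c0 *.
have a1 : (\sum_(N in reps n) (J <= n - kret N)%N = #|[set N in reps n | J <= n - kret N]|)%N.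
  rewrite -sum1_card big_mkcond [RHS]big_mkcond /=; apply: eq_bigr => N _.
  by rewrite !inE; case: (_ == N); case: (_ <= _)%N.
have b1 : (\sum_(N in reps n) (J <= n - kret N)%N)%:R <= (64 * M ^ 2)%N%:R / n%:R * c%:R :> R.
  rewrite a1 mulrAC ler_pdivlMr // -!natrM ler_nat.
  exact: many_leaves_rare.
have b2 : (4 ^ K)%N%:R * (4 * J)%N%:R / n%:R *+ c <= (4 * 4 ^ K)%N%:R / M%:R * c%:R :> R.
  rewrite -mulr_natr ler_wpM2r ?ler0n // ler_pdivrMr // mulrAC ler_pdivlMr // -!natrM ler_nat.
  have -> : (4 ^ K * (4 * J) * M = 4 * 4 ^ K * (J * M))%N by ring.
  by rewrite leq_mul2l hJ orbT.
have b3 : (4 ^ K)%N%:R * 8 / n%:R ^+ 2 *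
    (\sum_(N in reps n) #|short_rets L N| * (kret N - L.+2))%N%:R
    <= (32 * 4 ^ K * 4 ^ L)%N%:R / n%:R * c%:R :> R.
  have h := few_short_cycles n L; rewrite -/c in h.
  apply: (@le_trans _ _ ((4 ^ K)%N%:R * 8 / n%:R ^+ 2 * (c * (4 * n * 4 ^ L))%N%:R)).
    by rewrite ler_wpM2l ?ler_nat // divr_ge0 ?mulr_ge0 ?ler0n ?exprn_ge0.
  rewrite !natrM le_eqVlt; apply/orP; left; apply/eqP; field; lra.
rewrite natrD !mulrDl; lra.
Qed.

End Bound.

Lemma infinite_limit_vertex : infinite_set [set: limit_vertex].
Proof.
move=> fin; apply: infinite_nat.
have -> : [set: nat] = (fun m => SpineVertex SpineP (Posz m)) @^-1` [set: limit_vertex] by [].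
by apply: finite_preimage fin => x y _ _ [].
Qed.

(* There is no network on an empty set of taxa, so the sequence is indexed by
   n >= 0 with n.+1 taxa. *)
Theorem theorem1p8 (R : realType) (d : nat -> measure_display)
    (T : forall n : nat, measurableType (d n))
    (P : forall n : nat, probability (T n) R)
    (X : forall n : nat, T n -> pointed_network n.+1)
    (HX : forall n : nat, uniform_network_reticulation (P n) (X n)) :
  infinite_set [set: limit_vertex] /\
  local_weak_cvg P X reticulation_limit.
Proof.
split; first exact: infinite_limit_vertex.
move=> k; pose A n := [set t | looks_like_limit k (X n t)].
suff : (fun n => P n (A n)) @ \oo --> (1%E : \bar R) by [].
have mA n : measurable (A n) by exact: (measurable_looks_like_limit k (HX n)).
pose L := (k.+1 + k.+1)%N.
have hA n M : (1 < M)%N -> (0 < n)%N -> (4 * M <= n)%N -> (4 * L.+2 <= n)%N ->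
    1 - fine (P n (A n)) <= (4 * 4 ^ k.+2)%N%:R / M%:R + (64 * M ^ 2 + 32 * 4 ^ k.+2 * 4 ^ L)%N%:R / n.+1%:R.
  move=> M1 n0 Mn Ln; apply: le_trans (mean_bad_ratio_le R M1 _ (leqW Mn) (leqW Ln)) => //.
  rewrite -lee_fin; apply: le_trans (prob_bad k (HX n) (unr_network (HX n))).
  have -> : [set t | ~ looks_like_limit k (X n t)] = ~` A n by [].
  rewrite probability_setC // EFinB fineK //; exact: fin_num_measure.
apply/fine_cvgP; split; first by apply: nearW => n; apply: fin_num_measure.
apply/cvgrPdist_le => e e0.
(* [M] is fixed first, making [c1 / M] small; then [n] is taken large in terms of [c2], which
   depends on [M]. *)
pose c1 : R := (4 * 4 ^ k.+2)%N%:R.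
have [M M1 hM] : exists2 M, (1 < M)%N & c1 / M%:R <= e / 2.
  exists (Num.bound (c1 / (e / 2))).+2 => //.
  have h : c1 / (e / 2) < (Num.bound (c1 / (e / 2)))%:R.
    by apply: archi_boundP; rewrite divr_ge0 ?ler0n // divr_ge0 // ltW.
  rewrite ler_pdivrMr ?ltr0n // mulrC -ler_pdivrMr ?divr_gt0 //.
  by apply: le_trans (ltW h) _; rewrite ler_nat; lia.
pose c2 : R := (64 * M ^ 2 + 32 * 4 ^ k.+2 * 4 ^ L)%N%:R.
pose m := (Num.bound (c2 / (e / 2)) + (4 * M + 4 * L.+2))%N.
exists m => // n /= mn; rewrite /comp ger0_norm; last first.
  rewrite subr_ge0 -lee_fin fineK; last exact: fin_num_measure.
  exact: probability_le1.
apply: le_trans (hA n M M1 _ _ _) _; try by move: mn; rewrite /m; lia.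
have h2 : c2 / n.+1%:R <= e / 2.
  have h : c2 / (e / 2) < (Num.bound (c2 / (e / 2)))%:R.
    by apply: archi_boundP; rewrite divr_ge0 ?ler0n // divr_ge0 // ltW.
  rewrite ler_pdivrMr ?ltr0n // mulrC -ler_pdivrMr ?divr_gt0 //.
  by apply: le_trans (ltW h) _; rewrite ler_nat; move: mn; rewrite /m; lia.
by rewrite -/c1 -/c2 (splitr e) lerD.
Qed.
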